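(* The point spectrum of any selfadjoint extension $L_{W_1}$ (where $W_1$ is a unitary operator in $H$) of the minimal operator $L_0(1,0,1)$ in the Hilbert space $L^2(1,0,1)$ is empty, i.e. $\sigma_p(L_{W_1})=\emptyset$.
   Context: Let $H$ be a separable Hilbert space with $\dim H>0$, let $-\infty<a_1<a_3<+\infty$, and put $I_1=(-\infty,a_1)$, $I_3=(a_3,+\infty)$. For $k=1,3$ let $A_k:D(A_k)\subset H\to H$ be a linear selfadjoint operator. $L^2(H,I)$ denotes the Hilbert space of square-integrable $H$-valued functions on the interval $I$, and $L^2(1,0,1)=L^2(H,I_1)\oplus 0\oplus L^2(H,I_3)$, whose elements are written $u=(u_1,0,u_3)$. $H_{k,+}$ is $D(A_k)$ with inner product $(f,g)_{k,+}=(A_kf,A_kg)_H+(f,g)_H$; $H_{k,-}$ is the corresponding negative space, i.e. the completion of $H$ in the norm $\|f\|_{k,-}=\sup\{|(f,g)_H|/\|g\|_{k,+}: 0\ne g\in H_{k,+}\}$. $\tilde A_k:H\to H_{k,-}$ is the adjoint of the continuous operator $A_k:H_{k,+}\to H$; it is a continuous extension of $A_k$. Operators: the maximal operator $L_k$ acts by $L_ku=iu'+\tilde A_ku$ on the domain of all $u\in L^2(H,I_k)$ for which $iu'+\tilde A_ku$ (derivative in the sense of $H_{k,-}$-valued distributions) belongs to $L^2(H,I_k)$. Each such $u$ has a representative which is continuous into $H$ up to the finite endpoint of $I_k$, so its boundary value there is an element of $H$. The minimal operator $L_{k0}$ is the closure in $L^2(H,I_k)$ of the restriction of $L_k$ to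 finite sums $\sum_j\varphi_jh_j$ with $\varphi_j\in C_0^\infty(I_k)$, $h_j\in D(A_k)$. Put $L_0(1,0,1)=L_{10}\oplus0\oplus L_{30}$. For a unitary operator $W_1:H\to H$, $L_{W_1}$ is the selfadjoint extension of $L_0(1,0,1)$ in $L^2(1,0,1)$ obtained by restricting $L_1\oplus0\oplus L_3$ to those $u=(u_1,0,u_3)$ in its domain with $u_3(a_3)=W_1u_1(a_1)$. *)

(* Defs.v *)
From HB Require Import structures.
From mathcomp Require Import all_boot all_order all_algebra.
From mathcomp Require Import complex.
From mathcomp Require Import all_classical all_reals all_analysis.
From mathcomp Require Import sesquilinear.

Set Implicit Arguments.
Unset Strict Implicit.
Unset Printing Implicit Defensive.

Import Order.TTheory GRing.Theory Num.Theory.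
Import numFieldNormedType.Exports.

Local Open Scope classical_set_scope.
Local Open Scope ring_scope.
Local Open Scope complex_scope.

(* The norm of a normed space over R[i] takes its values in R[i]; this is the
   same norm with values in R. *)
Definition rnorm (R : realType) (E : normedModType R[i]) (x : E) : R :=
  complex.Re `|x|.

Definition separable (T : topologicalType) : Prop :=
  exists2 S : set T, countable S & dense S.

(* A complete normed space whose norm comes from dot.  Inner products are
   linear in the first argument and conjugate-linear in the second. *)
Definition is_hilbert (R : realType) (H : completeNormedModType R[i])
    (dot : {dot H for (@Num.conj R[i])}) : Prop :=
  forall u : H, `|u| ^+ 2 = dot u u.

Record linear_operator (K : nzRingType) (V : lmodType K) := LinearOperator {
  dom : set V;
  op :> V -> V;
  dom0 : dom 0;
  dom_linear : forall (a : K) u v, dom u -> dom v -> dom (a *: u + v);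
  op_linear : forall (a : K) u v, dom u -> dom v ->
    op (a *: u + v) = a *: op u + op v }.

Section HilbertSpaceOperators.
Context {R : realType} {H : completeNormedModType R[i]}.
Variable dot : {dot H for (@Num.conj R[i])}.

Definition graph (A : linear_operator H) : set (H * H) :=
  [set p | dom A p.1 /\ A p.1 = p.2].

Definition adjoint_graph (A : linear_operator H) : set (H * H) :=
  [set p | forall g, dom A g -> dot (A g) p.1 = dot g p.2].

Definition selfadjoint (A : linear_operator H) : Prop :=
  dense (dom A) /\ adjoint_graph A = graph A.

Definition unitary (W : {linear H -> H}) : Prop :=
  (forall u v, dot (W u) (W v) = dot u v) /\ range W = setT.

Section NegativeSpace.
Variable A : linear_operator H.

Definition dot_plus (f g : H) : R[i] := dot (A f) (A g) + dot f g.

Definition norm_plus (f : H) : R := Num.sqrt (complex.Re (dot_plus f f)).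

Definition norm_minus (f : H) : R :=
  sup [set complex.Re `|dot f g| / norm_plus g | g in [set g | dom A g /\ g != 0]].

(* A completion of H for norm_minus, unique up to isometric isomorphism. *)
Record negative_space := NegativeSpace {
  neg_sort :> completeNormedModType R[i];
  neg_emb : {linear H -> neg_sort};
  neg_emb_norm : forall f : H, rnorm (neg_emb f) = norm_minus f;
  neg_emb_dense : dense (range neg_emb) }.

Variable Hm : negative_space.

(* The extension by continuity of dot to Hm * dom A. *)
Definition pairing (y : Hm) (g : H) : R[i] :=
  xget 0 [set c : R[i] | forall f : nat -> H,
    neg_emb Hm (f n) @[n --> \oo] --> y ->
    (dot (f n) g : R[i]^o) @[n --> \oo] --> (c : R[i]^o)].

(* The adjoint of A : (dom A, norm_plus) -> H, with values in Hm. *)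
Definition tilde (f : H) : Hm :=
  xget 0 [set y : Hm | forall g, dom A g -> pairing y g = dot f (A g)].

End NegativeSpace.
End HilbertSpaceOperators.

Section BochnerIntegral.
Context {R : realType} {E : completeNormedModType R[i]}.
Local Notation mu := (@lebesgue_measure R).
Implicit Types (I : set R) (F : R -> E).

Definition simple (s : {fimfun R >-> E}) : Prop :=
  forall x : E, measurable (s @^-1` [set x]).

Definition strongly_measurable I F : Prop :=
  exists s : nat -> {fimfun R >-> E}, (forall n, simple (s n)) /\
    (forall t, I t -> s n t @[n --> \oo] --> F t).

Definition simple_integrable I (s : {fimfun R >-> E}) : Prop :=
  simple s /\ forall x : E, x != 0 -> (mu (I `&` s @^-1` [set x]) < +oo)%E.

Definition simple_integral I (s : {fimfun R >-> E}) : E :=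
  \sum_(x \in range s) (fine (mu (I `&` s @^-1` [set x])))%:C *: x.

Definition is_bochner_integral I F (y : E) : Prop :=
  exists s : nat -> {fimfun R >-> E},
    [/\ forall n, simple_integrable I (s n),
        forall t, I t -> s n t @[n --> \oo] --> F t,
        (\int[mu]_(t in I) (rnorm (F t - s n t))%:E)%E @[n --> \oo] --> 0%E &
        simple_integral I (s n) @[n --> \oo] --> y].

Definition bochner_integral I F : E := xget 0 (is_bochner_integral I F).

(* Elements of L^2(E, I) are represented by functions on R, of which only the
   restriction to I matters, and are equal when they agree a.e. on I. *)
Definition L2 I F : Prop :=
  strongly_measurable I F /\
  (\int[mu]_(t in I) ((rnorm (F t)) ^+ 2)%:E < +oo)%E.

End BochnerIntegral.

Section Distributions.
Context {R : realType}.

Definition smooth (f : R -> R) : Prop :=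
  forall n t, derivable (derive1n n f) t 1.

Definition test_function (I : set R) (phi : R -> R[i]) : Prop :=
  [/\ smooth (fun t => complex.Re (phi t)),
      smooth (fun t => complex.Im (phi t)) &
      exists K : set R, [/\ compact K, K `<=` I &
        forall t, ~ K t -> phi t = 0]].

Definition cderive (phi : R -> R[i]) : R -> R[i] := fun t =>
  derive1 (fun t => complex.Re (phi t)) t +i* derive1 (fun t => complex.Im (phi t)) t.

Context {E : completeNormedModType R[i]}.

(* E-valued distributions on I are maps on complex-valued functions, of which
   only the values on test functions on I matter. *)
Definition distr_of (I : set R) (F : R -> E) : (R -> R[i]) -> E :=
  fun phi => bochner_integral I (fun t => phi t *: F t).

Definition distr_deriv (T : (R -> R[i]) -> E) : (R -> R[i]) -> E :=
  fun phi => - T (cderive phi).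

End Distributions.

Section DifferentialOperators.
Context {R : realType} {H : completeNormedModType R[i]}.
Context {dot : {dot H for (@Num.conj R[i])}}.
Local Notation mu := (@lebesgue_measure R).

(* u is in the domain of the maximal operator on I, which maps u to w. *)
Definition maximal_operator (A : linear_operator H) (Hm : negative_space dot A)
    (I : set R) (u w : R -> H) : Prop :=
  [/\ L2 I u, L2 I w & forall phi, test_function I phi ->
    'i%C *: distr_deriv (distr_of I (neg_emb Hm \o u)) phi +
      distr_of I (tilde Hm \o u) phi =
    distr_of I (neg_emb Hm \o w) phi].

Definition boundary_value (I : set R) (a : R) (u : R -> H) (x : H) : Prop :=
  exists v : R -> H, [/\ {within closure I, continuous v},
    ae_eq mu I u v & v a = x].

(* A pair (u.1, u.2) stands for the element (u.1, 0, u.2) of L^2(1,0,1). *)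
Definition L_W (A1 A3 : linear_operator H)
    (Hm1 : negative_space dot A1) (Hm3 : negative_space dot A3)
    (a1 a3 : R) (W : H -> H) (u w : (R -> H) * (R -> H)) : Prop :=
  [/\ maximal_operator Hm1 `]-oo, a1[%classic u.1 w.1,
      maximal_operator Hm3 `]a3, +oo[%classic u.2 w.2 &
      exists x1 x3 : H, [/\ boundary_value `]-oo, a1[%classic a1 u.1 x1,
        boundary_value `]a3, +oo[%classic a3 u.2 x3 & x3 = W x1]].

Definition null101 (a1 a3 : R) (u : (R -> H) * (R -> H)) : Prop :=
  ae_eq mu `]-oo, a1[%classic u.1 (cst 0) /\ ae_eq mu `]a3, +oo[%classic u.2 (cst 0).

End DifferentialOperators.

(* The point spectrum of the operator with graph L in the quotient of V by the
   subspace null. *)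
Definition point_spectrum (K : nzRingType) (V : lmodType K) (null : V -> Prop)
    (L : V -> V -> Prop) : set K :=
  [set lam | exists u, ~ null u /\ L u (lam *: u)].

(* Main.v *)
Require Import Defs.
From mathcomp Require Import all_boot all_order all_algebra.
From mathcomp Require Import complex.
From mathcomp Require Import all_classical all_reals all_analysis.
From mathcomp Require Import sesquilinear.
From mathcomp Require Import measurable_realfun.
From mathcomp Require Import ring lra.

Set Implicit Arguments.
Unset Strict Implicit.
Unset Printing Implicit Defensive.

Import Order.TTheory GRing.Theory Num.Theory.
Import numFieldNormedType.Exports.
Import HBSimple.

Local Open Scope classical_set_scope.
Local Open Scope ring_scope.
Local Open Scope complex_scope.

(** An eigenfunction for lambda solves i u' + A u = lambda u on each half-line,
so formally u(t) = exp(- i lambda t) exp(i t A) u(0).  The group exp(i t A) is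
unitary, hence |u(t)| = exp(k (t - s)) |u(s)| with k = Im lambda.  If k <= 0,
then on the left half-line |u| is bounded below near -oo by its value at any
point, and square integrability forces u_1 = 0 [eigenfunction_eq0].  Its
boundary value is then 0, so the coupling gives u_3(a_3) = 0, and the growth
law read from the end point gives u_3 = 0.  If k > 0 the same argument starts on
the right half-line and comes back through W_1, which is isometric.

The work is in the growth law [eigenfunction_growth] for solutions that are
only weak.  It needs no functional calculus for A.  For a real test function f
put U(f) = int f u, a Bochner integral in H.  The embedding of H in H_- and the
extension of A to H are bounded linear maps, so they commute with Bochner
integrals, and the equation tested against f becomes, in H_-,
tilde A (U f) = lambda U(f) + i U(f').  Pairing it with the domain of A puts
U(f) in the domain of the adjoint, which is A itself: A (U f) = lambda U(f)
+ i U(f') [weak_eigenvalue_equation].  Since <A (U f), U f> is real, taking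
imaginary parts yields Re <U(f'), U(f)> = - k |U(f)|^2 [weak_energy_identity].
For the translates f(t) = g(t - s) of one bump, U(f') is minus the derivative of
U(f) in s, so |U(f)|^2 solves N' = 2 k N, and the growth law holds for U(f)
[translated_integral_growth].  When the support of g shrinks, |U(f)| divided by
int g tends to |v(s)|, for the continuous representative v [mollifier_le,
mollifier_ge], and the growth law passes to v.

Three ingredients are built on the way: the negative space as a space of
functionals on the domain of A [pairing_inj, tilde_spec], the Bochner integral
(uniqueness, existence, exchange with bounded maps), and smooth bumps of
arbitrarily small support [bump_exists]. *)

(** * Norms with real values *)

Section RealNorm.
Context {R : realType}.

Lemma normE (E : normedModType R[i]) (x : E) : `|x| = (rnorm x)%:C.
Proof.
by rewrite /rnorm RRe_real// ger0_real.
Qed.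

Lemma rnorm_ge0 (E : normedModType R[i]) (x : E) : 0 <= rnorm x.
Proof. by rewrite -lecR -normE normr_ge0. Qed.

Lemma rnorm0 (E : normedModType R[i]) : rnorm (0 : E) = 0.
Proof. by apply: complexI; rewrite -normE normr0. Qed.

Lemma rnorm_eq0 (E : normedModType R[i]) (x : E) : (rnorm x == 0) = (x == 0).
Proof.
by rewrite -(inj_eq (@complexI R)) -normE normr_eq0.
Qed.

Lemma rnormN (E : normedModType R[i]) (x : E) : rnorm (- x) = rnorm x.
Proof. by rewrite /rnorm normrN. Qed.

Lemma rdistC (E : normedModType R[i]) (x y : E) : rnorm (x - y) = rnorm (y - x).
Proof. by rewrite /rnorm distrC. Qed.

Lemma ler_rnormD (E : normedModType R[i]) (x y : E) :
  rnorm (x + y) <= rnorm x + rnorm y.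
Proof. by rewrite -lecR rmorphD/= -!normE ler_normD. Qed.

Lemma ler_rnormB (E : normedModType R[i]) (x y : E) :
  rnorm (x - y) <= rnorm x + rnorm y.
Proof. by rewrite -(rnormN y) ler_rnormD. Qed.

Lemma ler_rdistD (E : normedModType R[i]) (z x y : E) :
  rnorm (x - y) <= rnorm (x - z) + rnorm (z - y).
Proof. by rewrite -[x - y](subrKA z) ler_rnormD. Qed.

Lemma ler_rdist_dist (E : normedModType R[i]) (x y : E) :
  `|rnorm x - rnorm y| <= rnorm (x - y).
Proof.
rewrite ler_norml lerBlDr lerNl opprB lerBlDr.
apply/andP; split.
  by rewrite -{1}[y](subrK x) rdistC ler_rnormD.
by rewrite -{1}[x](subrK y) ler_rnormD.
Qed.

Lemma rnormZ (E : normedModType R[i]) (a : R[i]) (x : E) :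
  rnorm (a *: x) = rnorm (a : R[i]^o) * rnorm x.
Proof. by apply: complexI; rewrite rmorphM/= -!normE normrZ. Qed.

Lemma rnorm_real (r : R) : rnorm (r%:C : R[i]^o) = `|r|.
Proof. by rewrite /rnorm normc_def/= expr0n/= addr0 sqrtr_sqr. Qed.

Lemma rnormZr (E : normedModType R[i]) (r : R) (x : E) :
  rnorm (r%:C *: x) = `|r| * rnorm x.
Proof. by rewrite rnormZ rnorm_real. Qed.

Lemma Re_le_rnorm (z : R[i]) : `|complex.Re z| <= rnorm (z : R[i]^o).
Proof.
rewrite /rnorm normc_def/= -(sqrtr_sqr (complex.Re z)) ler_wsqrtr// lerDl.
exact: sqr_ge0.
Qed.

Lemma Im_le_rnorm (z : R[i]) : `|complex.Im z| <= rnorm (z : R[i]^o).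
Proof.
rewrite /rnorm normc_def/= -(sqrtr_sqr (complex.Im z)) ler_wsqrtr// lerDr.
exact: sqr_ge0.
Qed.

Lemma rnormi : rnorm ('i%C : R[i]^o) = 1.
Proof. by rewrite /rnorm normc_def/= expr0n/= expr1n add0r sqrtr1. Qed.

Lemma rnorm_le_ReIm (z : R[i]) :
  rnorm (z : R[i]^o) <= `|complex.Re z| + `|complex.Im z|.
Proof.
rewrite {1}[z]complexE; apply: (le_trans (ler_rnormD _ _)).
have -> : 'i%C * (complex.Im z)%:C = 'i%C *: ((complex.Im z)%:C : R[i]^o) by [].
by rewrite rnormZ !rnorm_real rnormi mul1r.
Qed.

Lemma rnorm_cvgP (E : normedModType R[i]) T (F : set_system T) {FF : Filter F}
    (f : T -> E) (y : E) :
  f x @[x --> F] --> y <->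
  (forall e : R, 0 < e -> \forall x \near F, rnorm (y - f x) < e).
Proof.
split=> [/cvgrPdist_lt fy e e0|fy].
  by have := fy e%:C; rewrite ltcR => /(_ e0); apply: filterS => x; rewrite normE ltcR.
apply/cvgrPdist_lt => e e0; have /RRe_real ee := gtr0_real e0.
have := fy (complex.Re e); rewrite -ltcR ee => /(_ e0).
by apply: filterS => x; rewrite normE -[in X in _ -> X]ee ltcR.
Qed.

Lemma rnorm_cvg0P (E : normedModType R[i]) T (F : set_system T) {FF : Filter F}
    (f : T -> E) (y : E) :
  f x @[x --> F] --> y <-> rnorm (y - f x) @[x --> F] --> (0 : R).
Proof.
rewrite rnorm_cvgP; split=> [fy|/cvgrPdist_lt fy e e0].
  apply/cvgrPdist_lt => e /fy; apply: filterS => x.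
  by rewrite sub0r normrN ger0_norm// rnorm_ge0.
by have := fy e e0; apply: filterS => x; rewrite sub0r normrN ger0_norm// rnorm_ge0.
Qed.

Lemma rnorm_cvg_le (E : normedModType R[i]) T (F : set_system T) {FF : Filter F}
    (f : T -> E) (y : E) (d : T -> R) :
  (\forall x \near F, rnorm (y - f x) <= d x) -> d x @[x --> F] --> 0 ->
  f x @[x --> F] --> y.
Proof.
move=> fd d0; apply/rnorm_cvgP => e e0.
move/cvgrPdist_lt : d0 => /(_ e e0) de; near=> x.
apply: (@le_lt_trans _ _ (d x)); first by near: x.
apply: (le_lt_trans (ler_norm _)); rewrite -normrN -sub0r.
by near: x.
Unshelve. all: by end_near. Qed.

Lemma cvg_rnorm (E : normedModType R[i]) T (F : set_system T) {FF : Filter F}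
    (f : T -> E) (y : E) :
  f x @[x --> F] --> y -> rnorm (f x) @[x --> F] --> rnorm y.
Proof.
move=> /rnorm_cvgP fy; apply/cvgrPdist_lt => e /fy.
by apply: filterS => x; apply: le_lt_trans; exact: ler_rdist_dist.
Qed.

(** A Cauchy criterion in the form in which it is met below: distances between
terms are bounded by the distances d of the terms to a common limit object. *)
Lemma dominated_cauchy_cvg (E : completeNormedModType R[i]) (x : nat -> E)
    (d : nat -> R) :
  (forall m n, rnorm (x m - x n) <= d m + d n) -> d n @[n --> \oo] --> 0 ->
  exists y : E, x n @[n --> \oo] --> y.
Proof.
move=> xd d0; suff : cvg (x @ \oo) by move=> h; exists (lim (x @ \oo)).
apply/cauchy_cvgP/cauchy_exP => e e0; have /RRe_real ee := gtr0_real e0.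
have e0' : 0 < complex.Re e by rewrite -ltcR ee.
move/cvgrPdist_lt : d0 => /(_ (complex.Re e / 2)); rewrite divr_gt0// => /(_ isT).
move=> [N _ dN]; exists (x N); exists N => // n /= Nn.
rewrite -ball_normE/= normE -ee ltcR; apply: (le_lt_trans (xd _ _)).
rewrite [ltRHS]splitr; apply: ltrD; apply: (le_lt_trans (ler_norm _)).
  by rewrite -normrN -sub0r; apply: dN => /=.
by rewrite -normrN -sub0r; apply: dN.
Qed.

(** Completeness of the complex numbers, read off the real and imaginary parts. *)
Lemma complex_dominated_cauchy_cvg (x : nat -> R[i]) (d : nat -> R) :
  (forall m n, rnorm (x m - x n : R[i]^o) <= d m + d n) ->
  d n @[n --> \oo] --> 0 ->
  exists y : R[i], (x n : R[i]^o) @[n --> \oo] --> (y : R[i]^o).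
Proof.
move=> xd d0.
have key (p : {additive R[i] -> R}) :
    (forall z, `|p z| <= rnorm (z : R[i]^o)) -> exists r : R, p (x n) @[n --> \oo] --> r.
  move=> ple; suff : cvg (p \o x @ \oo).
    by move=> h; exists (lim (p \o x @ \oo)).
  apply/cauchy_cvgP/cauchy_exP => e e0.
  move/cvgrPdist_lt : d0 => /(_ (e / 2)); rewrite divr_gt0// => /(_ isT).
  move=> [N _ dN]; exists (p (x N)); exists N => // n /= Nn.
  rewrite -ball_normE/= -raddfB; apply: (le_lt_trans (ple _)).
  apply: (le_lt_trans (xd _ _)).
  rewrite [ltRHS]splitr; apply: ltrD; apply: (le_lt_trans (ler_norm _)).
    by rewrite -normrN -sub0r; apply: dN => /=.
  by rewrite -normrN -sub0r; apply: dN.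
have [a xa] := key _ Re_le_rnorm; have [b xb] := key _ Im_le_rnorm.
exists (a +i* b); apply: (@rnorm_cvg_le _ _ _ _ _ _ (fun n =>
  `|a - complex.Re (x n)| + `|b - complex.Im (x n)|)).
  by apply: nearW => n; apply: (le_trans (rnorm_le_ReIm _)); case: (x n).
rewrite -[X in _ --> X](addr0 (0 : R)); apply: cvgD.
  rewrite -(normr0 R) -(subrr a); apply: cvg_norm; apply: cvgB => //; exact: cvg_cst.
rewrite -(normr0 R) -(subrr b); apply: cvg_norm; apply: cvgB => //; exact: cvg_cst.
Qed.

End RealNorm.

(** * Hilbert space and negative space *)

Section HilbertSpace.
Context {R : realType} {H : completeNormedModType R[i]}.
Variable dot : {dot H for (@Num.conj R[i])}.
Hypothesis hH : is_hilbert dot.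

Lemma dotC u v : dot u v = Num.conj (dot v u).
Proof. by rewrite [LHS]hermC expr0 mul1r. Qed.

Lemma dot_self u : dot u u = (rnorm u ^+ 2)%:C.
Proof. by rewrite -hH normE -rmorphXn. Qed.

Lemma rnorm_sqr u : rnorm u ^+ 2 = complex.Re (dot u u).
Proof. by rewrite dot_self. Qed.

(** The usual proof: the square of the norm of u minus its projection on v is
nonnegative. *)
Lemma dot_cauchy_schwarz u v : rnorm (dot u v : R[i]^o) <= rnorm u * rnorm v.
Proof.
have [->|v0] := eqVneq v 0.
  by rewrite linear0r !rnorm0 mulr0.
have dv : 0 < dot v v by rewrite dnorm_gt0.
have dvn : dot v v != 0 by rewrite gt_eqF.
rewrite -(@ler_pXn2r _ 2)// ?nnegrE ?mulr_ge0 ?rnorm_ge0//.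
have -> : (rnorm u * rnorm v) ^+ 2 = complex.Re (dot u u * dot v v).
  by rewrite !dot_self -rmorphM exprMn.
rewrite -lecR rmorphXn/= -normE RRe_real; last by rewrite realM// ger0_real// dnorm_ge0.
rewrite -ler_pdivrMr//.
rewrite -subr_ge0.
suff -> : dot u u - `|dot u v| ^+ 2 / dot v v =
    dot (u - (dot u v / dot v v) *: v) (u - (dot u v / dot v v) *: v).
  by rewrite dnorm_ge0.
have cv : Num.conj (dot v v) = dot v v by rewrite conj_Creal// gtr0_real.
rewrite dnormB dnormZ linearZr_LR/= rmorphM fmorphV/= cv.
rewrite normrM normfV (gtr0_norm dv) rmorphM/= rmorphM/= fmorphV/= cv conjCK.
rewrite (mulrAC (Num.conj (dot u v)) _ (dot u v)) (mulrC (Num.conj (dot u v))) -normCK.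
rewrite -addrA; congr (_ + _).
rewrite (mulrAC (dot u v)) -normCK expr_div_n (expr2 (dot v v)) invfM mulrA.
by rewrite mulfVK// opprD addrA subrr add0r.
Qed.

Lemma cvg_dot T (F : set_system T) {FF : Filter F} (f : T -> H) (x g : H) :
  f t @[t --> F] --> x -> (dot (f t) g : R[i]^o) @[t --> F] --> (dot x g : R[i]^o).
Proof.
move=> /rnorm_cvg0P fx; apply: (@rnorm_cvg_le _ _ _ _ _ _ _
  (fun t => rnorm (x - f t) * rnorm g)).
  by apply: nearW => t; rewrite -linearBl; exact: dot_cauchy_schwarz.
by rewrite -(mul0r (rnorm g)); apply: cvgM => //; exact: cvg_cst.
Qed.

Section NegativeSpace.
Variable A : linear_operator H.
Hypothesis hA : selfadjoint dot A.
Variable Hm : negative_space dot A.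

Lemma selfadjoint_symmetric f g : dom A f -> dom A g -> dot (A f) g = dot f (A g).
Proof.
move=> Af Ag; have : graph A (g, A g) by split.
by rewrite -hA.2 => /(_ f Af).
Qed.

(** The only use of maximality: A contains its adjoint.  It replaces every
regularity argument on the averages of a weak solution. *)
Lemma selfadjoint_dom x z : (forall g, dom A g -> dot x (A g) = dot z g) ->
  dom A x /\ A x = z.
Proof.
move=> xz; have : adjoint_graph dot A (x, z).
  by move=> g Ag /=; rewrite dotC xz// -dotC.
by rewrite hA.2.
Qed.

Lemma op_sub (f g : H) : dom A f -> dom A g ->
  dom A (f - g) /\ A (f - g) = A f - A g.
Proof.
move=> Af Ag; rewrite -(scaleN1r g) addrC; split; first exact: dom_linear.
by rewrite op_linear// scaleN1r addrC.
Qed.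

Lemma norm_plusE g : norm_plus dot A g = Num.sqrt (rnorm (A g) ^+ 2 + rnorm g ^+ 2).
Proof. by rewrite /norm_plus /dot_plus !dot_self. Qed.

Lemma rnorm_le_norm_plus g : rnorm g <= norm_plus dot A g.
Proof.
rewrite norm_plusE -[leLHS]ger0_norm ?rnorm_ge0// -sqrtr_sqr ler_wsqrtr//.
by rewrite lerDr sqr_ge0.
Qed.

Lemma rnorm_op_le_norm_plus g : rnorm (A g) <= norm_plus dot A g.
Proof.
rewrite norm_plusE -[leLHS]ger0_norm ?rnorm_ge0// -sqrtr_sqr ler_wsqrtr//.
by rewrite lerDl sqr_ge0.
Qed.

Lemma norm_plus_gt0 g : g != 0 -> 0 < norm_plus dot A g.
Proof.
move=> g0; apply: lt_le_trans (rnorm_le_norm_plus g).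
by rewrite lt_neqAle rnorm_ge0 eq_sym rnorm_eq0 g0.
Qed.

(** M >= 0 is needed when the domain of A is trivial: the supremum is then 0. *)
Lemma norm_minus_le f (M : R) : 0 <= M ->
  (forall g, dom A g -> rnorm (dot f g : R[i]^o) <= M * norm_plus dot A g) ->
  norm_minus dot A f <= M.
Proof.
move=> M0 fM; rewrite /norm_minus.
set S := [set _ | _ in _].
have [S0|Sn0] := pselect (S !=set0); last first.
  by rewrite (_ : S = set0) ?sup0//; apply/seteqP; split=> // x Sx; apply: Sn0; exists x.
apply: ge_sup => // _ [g [Ag g0] <-].
by rewrite ler_pdivrMr ?norm_plus_gt0//; exact: fM.
Qed.

(** The supremum is over a set bounded by |f|, by Cauchy-Schwarz. *)
Lemma dot_le_norm_minus f g : dom A g ->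
  rnorm (dot f g : R[i]^o) <= norm_minus dot A f * norm_plus dot A g.
Proof.
move=> Ag; have [->|g0] := eqVneq g 0.
  by rewrite linear0r rnorm0 mulr_ge0// ?sqrtr_ge0// -(neg_emb_norm Hm) rnorm_ge0.
rewrite -ler_pdivrMr ?norm_plus_gt0//; apply: ub_le_sup; last by exists g.
exists (rnorm f) => _ [h [Ah h0] <-]; rewrite ler_pdivrMr ?norm_plus_gt0//.
apply: (le_trans (dot_cauchy_schwarz _ _)).
by rewrite ler_wpM2l ?rnorm_ge0// rnorm_le_norm_plus.
Qed.

Lemma rnorm_neg_emb_le f : rnorm (neg_emb Hm f) <= rnorm f.
Proof.
rewrite neg_emb_norm; apply: norm_minus_le; first exact: rnorm_ge0.
move=> g _; apply: (le_trans (dot_cauchy_schwarz _ _)).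
by rewrite ler_wpM2l ?rnorm_ge0// rnorm_le_norm_plus.
Qed.

(** Moving A to the other factor bounds the negative norm of A f by the norm
of f in H; this is what lets A extend to the whole of H. *)
Lemma rnorm_neg_emb_op_le f : dom A f -> rnorm (neg_emb Hm (A f)) <= rnorm f.
Proof.
move=> Af; rewrite neg_emb_norm; apply: norm_minus_le; first exact: rnorm_ge0.
move=> g Ag; rewrite selfadjoint_symmetric//.
apply: (le_trans (dot_cauchy_schwarz _ _)).
by rewrite ler_wpM2l ?rnorm_ge0// rnorm_op_le_norm_plus.
Qed.

Lemma dot_le_neg_emb f g : dom A g ->
  rnorm (dot f g : R[i]^o) <= rnorm (neg_emb Hm f) * norm_plus dot A g.
Proof. by rewrite neg_emb_norm; exact: dot_le_norm_minus. Qed.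

Lemma dense_cvg (E : normedModType R[i]) (S : set E) (y : E) : dense S ->
  exists f : nat -> E, (forall n, S (f n)) /\ (forall n, rnorm (y - f n) < n.+1%:R^-1).
Proof.
move=> dS; suff /choice[f fP] : forall n, exists x, S x /\ rnorm (y - x) < n.+1%:R^-1.
  by exists f; split=> n; case: (fP n).
move=> n; have n0 : (0 : R[i]) < (n.+1%:R^-1 : R)%:C by rewrite ltcR invr_gt0.
have [|x [yx Sx]] := dS _ _ (ball_open y (n.+1%:R^-1 : R)%:C).
  by exists y; exact: ballxx.
by exists x; split=> //; move: yx; rewrite -ball_normE/= normE ltcR.
Qed.

(** The defining property of the pairing, as a predicate: the pairing picks such
a number when there is one. *)
Definition is_pairing (y : Hm) (g : H) (c : R[i]) := forall f : nat -> H,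
  neg_emb Hm (f n) @[n --> \oo] --> y ->
  (dot (f n) g : R[i]^o) @[n --> \oo] --> (c : R[i]^o).

(** The rate 1/(n+1) makes these sequences Cauchy with an explicit bound. *)
Lemma neg_emb_seq (y : Hm) : exists f : nat -> H,
  forall n, rnorm (y - neg_emb Hm (f n)) < n.+1%:R^-1.
Proof.
have [f [fr fy]] := dense_cvg y (@neg_emb_dense _ _ _ _ Hm).
have /choice[h hP] : forall n, exists x, neg_emb Hm x = f n.
  by move=> n; have [x _ xf] := fr n; exists x.
by exists h => n; rewrite hP.
Qed.

(** The limit defining the pairing is the same for all sequences, because
|<f, g>| is at most the negative norm of f times the positive norm of g. *)
Lemma neg_emb_cvg_dot (f f' : nat -> H) (y : Hm) g (c : R[i]) : dom A g ->
  neg_emb Hm (f n) @[n --> \oo] --> y -> neg_emb Hm (f' n) @[n --> \oo] --> y ->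
  (dot (f n) g : R[i]^o) @[n --> \oo] --> (c : R[i]^o) ->
  (dot (f' n) g : R[i]^o) @[n --> \oo] --> (c : R[i]^o).
Proof.
move=> Ag fy f'y fc.
apply: (@rnorm_cvg_le _ _ _ _ _ _ _ (fun n => rnorm (c - dot (f n) g : R[i]^o) +
   (rnorm (y - neg_emb Hm (f n)) + rnorm (y - neg_emb Hm (f' n))) * norm_plus dot A g)).
  apply: nearW => n; apply: (le_trans (ler_rdistD (dot (f n) g : R[i]^o) _ _)).
  rewrite lerD2l -linearBl; apply: (le_trans (dot_le_neg_emb _ Ag)).
  rewrite ler_wpM2r ?sqrtr_ge0// linearB/= [leRHS]addrC (rdistC y (neg_emb Hm (f n))).
  by rewrite addrC ler_rdistD.
rewrite -[X in _ --> X](addr0 (0 : R)); apply: cvgD; first exact/rnorm_cvg0P.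
rewrite -(mul0r (norm_plus dot A g)) -(addr0 0); apply: cvgM; last exact: cvg_cst.
by apply: cvgD; exact/rnorm_cvg0P.
Qed.

Lemma rnorm_lt_inv_cvg (E : normedModType R[i]) (f : nat -> E) y :
  (forall n, rnorm (y - f n) < n.+1%:R^-1) -> f n @[n --> \oo] --> y.
Proof.
move=> fy; apply: (@rnorm_cvg_le _ _ _ _ _ _ _ (fun n => n.+1%:R^-1)).
  by apply: nearW => n; exact/ltW.
exact: cvg_harmonic.
Qed.

Lemma complex_cvg_unique (f : nat -> R[i]) (a b : R[i]) :
  (f n : R[i]^o) @[n --> \oo] --> (a : R[i]^o) ->
  (f n : R[i]^o) @[n --> \oo] --> (b : R[i]^o) -> a = b.
Proof. by move=> fa fb; exact: (cvg_unique (@norm_hausdorff _ R[i]^o) fa fb). Qed.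

Lemma pairingP y g c : is_pairing y g c -> pairing y g = c.
Proof.
move=> yc; rewrite /pairing; set P := [set c | _].
have Pc : P c by [].
have Pp : P (xget 0 P) := xgetI 0 Pc.
have [f fy] := neg_emb_seq y.
apply: (@complex_cvg_unique (fun n => dot (f n) g)).
  by apply: Pp; exact: rnorm_lt_inv_cvg.
by apply: yc; exact: rnorm_lt_inv_cvg.
Qed.

(** The limit exists for each y, so the default value of the pairing is never
taken on the domain of A. *)
Lemma is_pairing_pairing y g : dom A g -> is_pairing y g (pairing y g).
Proof.
move=> Ag; have [f fy] := neg_emb_seq y.
have [c fc] : exists c : R[i], (dot (f n) g : R[i]^o) @[n --> \oo] --> (c : R[i]^o).
  apply: (@complex_dominated_cauchy_cvg _ _ (fun n => n.+1%:R^-1 * norm_plus dot A g)).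
    move=> m n; rewrite -linearBl -mulrDl; apply: (le_trans (dot_le_neg_emb _ Ag)).
    rewrite ler_wpM2r ?sqrtr_ge0// linearB/=; apply: (le_trans (ler_rdistD y _ _)).
    by rewrite rdistC lerD// ltW.
  rewrite -(mul0r (norm_plus dot A g)); apply: cvgM; last exact: cvg_cst.
  exact: cvg_harmonic.
have yc : is_pairing y g c.
  move=> f' f'y; apply: (neg_emb_cvg_dot Ag _ f'y fc); exact: rnorm_lt_inv_cvg.
by rewrite (pairingP yc).
Qed.

Lemma pairing_emb f g : dom A g -> pairing (neg_emb Hm f) g = dot f g.
Proof.
move=> Ag; apply: (@complex_cvg_unique (fun=> dot f g)); last exact: cvg_cst.
by apply: (is_pairing_pairing Ag (f := fun=> f)); exact: cvg_cst.
Qed.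

Lemma rnorm_pairing_le (y : Hm) g : dom A g ->
  rnorm (pairing y g : R[i]^o) <= rnorm y * norm_plus dot A g.
Proof.
move=> Ag; have [f fy] := neg_emb_seq y.
have /cvg_rnorm h := is_pairing_pairing Ag (rnorm_lt_inv_cvg fy).
have /cvg_rnorm k := rnorm_lt_inv_cvg fy.
have {}k : rnorm (neg_emb Hm (f n)) * norm_plus dot A g @[n --> \oo] -->
    rnorm y * norm_plus dot A g.
  exact: (cvgM k (cvg_cst _)).
apply: (ler_cvg_to h k).
by apply: nearW => n; exact: dot_le_neg_emb.
Qed.

Lemma pairing_linear (a : R[i]) (y z : Hm) g : dom A g ->
  pairing (a *: y + z) g = a * pairing y g + pairing z g.
Proof.
move=> Ag; have [f /rnorm_lt_inv_cvg fy] := neg_emb_seq y.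
have [h /rnorm_lt_inv_cvg hz] := neg_emb_seq z.
apply: (@complex_cvg_unique (fun n => dot (a *: f n + h n) g)).
  apply: (is_pairing_pairing Ag); under eq_fun do rewrite linearP.
  by apply: cvgD => //; apply: cvgZr.
under eq_fun do rewrite linearPl/=.
apply: cvgD; last exact: is_pairing_pairing.
by apply: (@cvgZr _ (R[i]^o)); exact: is_pairing_pairing.
Qed.

(** Elements of the negative space are determined by their values on the domain
of A.  If all the values of x vanish and the embeddings of f n tend to x, then
<f n, g> is the value of f n - x at g, so the negative norm of f n is at most
its distance to x; both tend to 0. *)
Lemma pairing_inj (y z : Hm) :
  (forall g, dom A g -> pairing y g = pairing z g) -> y = z.
Proof.
move=> yz; apply/eqP; rewrite -subr_eq0 -rnorm_eq0.
have {}yz g : dom A g -> pairing (y - z) g = 0.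
  by move=> Ag; rewrite -(scaleN1r z) addrC pairing_linear// yz// mulN1r addNr.
move: (y - z) yz => {z}x x0.
have [f fx] := neg_emb_seq x.
have bnd n : rnorm (neg_emb Hm (f n)) <= rnorm (x - neg_emb Hm (f n)).
  rewrite neg_emb_norm; apply: norm_minus_le; first exact: rnorm_ge0.
  move=> g Ag; rewrite -(pairing_emb (f n)) //.
  have -> : pairing (neg_emb Hm (f n)) g = pairing (-1 *: (x - neg_emb Hm (f n)) + x) g.
    by rewrite scaleN1r opprB subrK.
  rewrite pairing_linear// x0// addr0.
  by rewrite mulN1r (rnormN (_ : R[i]^o)) rnorm_pairing_le.
rewrite eq_le rnorm_ge0 andbT.
have /cvg_rnorm k := rnorm_lt_inv_cvg fx.
have /rnorm_cvg0P d := rnorm_lt_inv_cvg fx.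
by apply: (ler_cvg_to k d); exact: nearW.
Qed.

(** Take h n in the domain of A tending to f.  Then A (h n) is a Cauchy sequence
in the negative space, and its limit represents g |-> <f, A g>. *)
Lemma tilde_spec f : (forall g, dom A g -> pairing (tilde Hm f) g = dot f (A g)) /\
  rnorm (tilde Hm f) <= rnorm f.
Proof.
have [h [Ah fh]] := dense_cvg f hA.1.
have [y hy] : exists y : Hm, neg_emb Hm (A (h n)) @[n --> \oo] --> y.
  apply: (@dominated_cauchy_cvg _ _ _ (fun n => n.+1%:R^-1)); last exact: cvg_harmonic.
  move=> m n; have [dmn Amn] := op_sub (Ah m) (Ah n).
  rewrite -linearB/= -Amn; apply: (le_trans (rnorm_neg_emb_op_le dmn)).
  apply: (le_trans (ler_rdistD f _ _)).
  by rewrite rdistC lerD// ltW.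
have yP g : dom A g -> pairing y g = dot f (A g).
  move=> Ag; apply: (@complex_cvg_unique (fun n => dot (A (h n)) g)).
    exact: is_pairing_pairing.
  under eq_fun do rewrite selfadjoint_symmetric//.
  by apply: cvg_dot; exact: rnorm_lt_inv_cvg.
have -> : tilde Hm f = y.
  rewrite /tilde; set P := [set y : Hm | _].
  have Py : P y by [].
  have Pp : P (xget 0 P) := xgetI 0 Py.
  by apply: pairing_inj => g Ag; rewrite yP// Pp.
split=> //.
apply: (ler_cvg_to (cvg_rnorm hy) (cvg_rnorm (rnorm_lt_inv_cvg fh))).
by apply: nearW => n; exact: rnorm_neg_emb_op_le.
Qed.

Lemma rnorm_tilde_le f : rnorm (tilde Hm f) <= rnorm f.
Proof. by case: (tilde_spec f). Qed.

Lemma pairing_tilde f g : dom A g -> pairing (tilde Hm f) g = dot f (A g).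
Proof. by case: (tilde_spec f) => + _; exact. Qed.

Lemma tilde_linear (a : R[i]) f h : tilde Hm (a *: f + h) = a *: tilde Hm f + tilde Hm h.
Proof.
apply: pairing_inj => g Ag.
by rewrite pairing_linear// !pairing_tilde// linearPl.
Qed.

(** Pairing with g turns the equation into <x, A g> = <z, g> for all g in the
domain of A, that is, into a statement about the adjoint of A. *)
Lemma tilde_eq_emb x z : tilde Hm x = neg_emb Hm z -> dom A x /\ A x = z.
Proof.
move=> xz; apply: selfadjoint_dom => g Ag.
by rewrite -pairing_tilde// xz pairing_emb.
Qed.

End NegativeSpace.
End HilbertSpace.

(** * Integrals of vector-valued simple functions *)

Section SimpleFunctions.
Context {R : realType}.
Local Notation mu := (@lebesgue_measure R).
Variables (I : set R) (mI : measurable I).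

Lemma trivIset_level_sets (T : choiceType) (p : R -> T) (D : set T) :
  trivIset D (fun q => I `&` p @^-1` [set q]).
Proof.
apply/trivIsetP => a b _ _ ab; apply/eqP/negPn.
apply/negP => /set0P[t [[_ /= pa] [_ /= pb]]].
by rewrite -pa -pb eqxx in ab.
Qed.

(** The codomain of p carries no sigma-algebra: measurability of the finitely
many fibres suffices. *)
Lemma finite_range_preimage_measurable T (p : R -> T) (Y : set T) : finite_set (range p) ->
  (forall q, measurable (p @^-1` [set q])) -> measurable (p @^-1` Y).
Proof.
move=> fp mp; have -> : p @^-1` Y = \bigcup_(q in range p `&` Y) p @^-1` [set q].
  apply/seteqP; split=> [t Yt|t [q [_ Yq] /= ->]]//.
  by exists (p t) => //; split=> //; exists t.
by apply: fin_bigcup_measurable => //; exact: finite_setIl.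
Qed.

Context {E : completeNormedModType R[i]}.

(** The integral of a simple function may be computed over the fibres of any
finite-valued p through which it factors.  Linearity of the integral follows,
with p the pair of two simple functions. *)
Lemma simple_integral_refine (T : choiceType) (p : R -> T) (f : T -> E)
    (s : {fimfun R >-> E}) : finite_set (range p) ->
  (forall q, measurable (p @^-1` [set q])) -> (forall t, s t = f (p t)) ->
  simple_integrable I s ->
  simple_integral I s =
    \sum_(q \in range p) (fine (mu (I `&` p @^-1` [set q])))%:C *: f q.
Proof.
move=> fp mp sfp [ms fs].
have rs : range s = f @` range p.
  by apply/seteqP; split=> [_ [t _ <-]|_ [_ [t _ <-] <-]];
    [exists (p t) => //; exists t|exists t].
rewrite /simple_integral rs !fsbig_finite//=; last exact: finite_image.
rewrite fset_set_image// [RHS](finmap.partition_big_imfset _ f)/=.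
apply: eq_bigr => x _.
(* The value 0 may have a fibre of infinite measure, but contributes nothing. *)
have [->|x0] := eqVneq x 0.
  rewrite scaler0 big1// => q /eqP ->; exact: scaler0.
rewrite [RHS](eq_bigr (fun q => (fine (mu (I `&` p @^-1` [set q])))%:C *: x)); last first.
  by move=> q /eqP ->.
rewrite -scaler_suml -(rmorph_sum (real_complex R)); congr (_%:C *: _).
set r := [seq q <- finmap.enum_fset (fset_set (range p)) | f q == x].
have -> : I `&` s @^-1` [set x] = \bigcup_(q in [set` r]) (I `&` p @^-1` [set q]).
  apply/seteqP; split=> [t [It /= sx]|t [q /= + [It /= ptq]]].
    exists (p t) => //=; rewrite mem_filter -sfp sx eqxx/= in_fset_set//.
    by apply/mem_set; exists t.
  by rewrite mem_filter => /andP[/eqP fqx _]; split=> //=; rewrite sfp ptq.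
have ur : uniq r by rewrite filter_uniq.
have fin q : f q == x -> mu (I `&` p @^-1` [set q]) \is a fin_num.
  move=> /eqP fqx; rewrite ge0_fin_numE//.
  apply: le_lt_trans (fs x x0); apply: le_measure; rewrite ?inE.
  - apply: measurableI; [exact: mI|exact: mp].
  - by apply: measurableI => //; exact: ms.
  - by apply: setIS => t /= ptq; rewrite sfp ptq.
rewrite measure_fin_bigcup//; last 2 first.
- exact: trivIset_level_sets.
- by move=> q _; apply: measurableI; [exact: mI|exact: mp].
by rewrite -fsbig_seq// /r big_filter -sum_fine.
Qed.


Lemma simple_preimage_measurable (s : {fimfun R >-> E}) (Y : set E) :
  simple s -> measurable (s @^-1` Y).
Proof. by move=> ms; apply: finite_range_preimage_measurable => //; exact: ms. Qed.

Lemma measurable_fun_simple (f : E -> R) (s : {fimfun R >-> E}) :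
  simple s -> measurable_fun I (EFin \o (f \o s)).
Proof.
move=> ms; apply/measurable_EFinP => _ Y mY; rewrite comp_preimage; apply: measurableI => //.
exact: (simple_preimage_measurable (f @^-1` Y) ms).
Qed.

Lemma integral_rnorm_simple (s : {fimfun R >-> E}) : simple_integrable I s ->
  (\int[mu]_(t in I) (rnorm (s t))%:E =
   (\sum_(x \in range s) fine (mu (I `&` s @^-1` [set x])) * rnorm x)%:E)%E.
Proof.
move=> [ms fs].
set r := finmap.enum_fset (fset_set (range s)).
have rr : [set` r] = range s by rewrite /r fset_setK.
have IU : I = \big[setU/set0]_(x <- r) (I `&` s @^-1` [set x]).
  rewrite -bigcup_seq rr; apply/seteqP; split=> [t It|t [x _ []]//].
  by exists (s t) => //; exists t.
have mF x : measurable (I `&` s @^-1` [set x]).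
  by apply: measurableI => //; exact: ms.
rewrite {1}IU ge0_integral_bigsetU//=; last 4 first.
- exact: finmap.fset_uniq.
- exact: trivIset_level_sets.
- rewrite -IU; exact: (measurable_fun_simple (@rnorm R E)).
- by move=> t _; rewrite lee_fin rnorm_ge0.
rewrite fsbig_finite//= -sumEFin; apply: eq_bigr => x _.
rewrite (eq_integral (fun=> (rnorm x)%:E)); last first.
  by move=> t; rewrite inE => -[_ /= ->].
rewrite integral_cst; last exact: mF.
rewrite EFinM [LHS]muleC.
have [->|x0] := eqVneq x 0; first by rewrite rnorm0 !mule0.
by rewrite fineK// ge0_fin_numE// fs.
Qed.

Lemma simple_integral_le (s : {fimfun R >-> E}) : simple_integrable I s ->
  ((rnorm (simple_integral I s))%:E <= \int[mu]_(t in I) (rnorm (s t))%:E)%E.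
Proof.
move=> is_; rewrite integral_rnorm_simple// lee_fin /simple_integral !fsbig_finite//=.
elim/big_ind2 : _ => [|x a y b xa yb|x _].
- by rewrite rnorm0.
- exact: (le_trans (ler_rnormD _ _) (lerD xa yb)).
- by rewrite rnormZr ger0_norm// fine_ge0.
Qed.

Lemma finite_range_pair (T U : Type) (s : R -> T) (s' : R -> U) :
  finite_set (range s) -> finite_set (range s') ->
  finite_set (range (fun t => (s t, s' t))).
Proof.
move=> fs fs'; apply: sub_finite_set (finite_setX fs fs').
by move=> _ [t _ <-]; split; exists t.
Qed.

Lemma measurable_preimage_pair (T U : Type) (p : R -> T) (q : R -> U) z :
  (forall x, measurable (p @^-1` [set x])) ->
  (forall x, measurable (q @^-1` [set x])) ->
  measurable ((fun t => (p t, q t)) @^-1` [set z]).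
Proof.
move=> mp mq; have -> : (fun t => (p t, q t)) @^-1` [set z] =
    p @^-1` [set z.1] `&` q @^-1` [set z.2].
  by case: z => a b; apply/seteqP; split=> t /= [] -> ->.
exact: measurableI.
Qed.

(** Where s + s' is nonzero one of s, s' is nonzero, which gives finiteness of
the measures; additivity is a refinement along the pair (s, s'). *)
Lemma simple_integrableD (s s' : {fimfun R >-> E}) :
  simple_integrable I s -> simple_integrable I s' ->
  simple_integrable I (s + s') /\
  simple_integral I (s + s') = simple_integral I s + simple_integral I s'.
Proof.
move=> is1 is2; have [ms fs] := is1; have [ms' fs'] := is2.
have fp := finite_range_pair (fimfunP s) (fimfunP s').
have mp q := measurable_preimage_pair q ms ms'.
have ip : simple_integrable I (s + s').
  split=> x.
    have -> : (s + s') @^-1` [set x] = (fun t => (s t, s' t)) @^-1`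
        [set q | q.1 + q.2 = x] by [].
    exact: finite_range_preimage_measurable.
  move=> x0.
  have sub : I `&` (s + s') @^-1` [set x] `<=`
      (I `&` s @^-1` (range s `\ 0)) `|` (I `&` s' @^-1` (range s' `\ 0)).
    move=> t [It /= stx]; have {}stx : s t + s' t = x := stx.
    have [st0|st0] := eqVneq (s t) 0; last first.
      by left; split=> //=; split; [exists t|exact/eqP].
    right; split=> //=; split; first by exists t.
    by move=> s't0; move: x0; rewrite -stx st0 s't0 addr0 eqxx.
  have fin (u : {fimfun R >-> E}) : simple_integrable I u ->
      (mu (I `&` u @^-1` (range u `\ (0 : E)%R)) < +oo)%E.
    move=> [mu_ fu].
    have -> : I `&` u @^-1` (range u `\ 0) =
        \bigcup_(x in range u `\ 0) (I `&` u @^-1` [set x]).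
      apply/seteqP; split=> [t [It [r0 r1]]|t [y [yu y0] [It /= ->]]]; last by split.
      by exists (u t).
    rewrite measure_fin_bigcup//; last 3 first.
    - exact: finite_setD.
    - exact: trivIset_level_sets.
    - by move=> q _; apply: measurableI; [exact: mI|exact: mu_].
    rewrite fsbig_finite/=; last exact: finite_setD.
    rewrite big_seq; apply: lte_sum_pinfty => y.
    rewrite in_fset_set; last exact: finite_setD.
    by rewrite inE => -[_ /eqP y0]; exact: fu.
  have mU (u : {fimfun R >-> E}) : simple_integrable I u ->
      measurable (I `&` u @^-1` (range u `\ 0)).
    by move=> [mu_ _]; apply: measurableI => //; exact: simple_preimage_measurable.
  apply: (@le_lt_trans _ _ (mu ((I `&` s @^-1` (range s `\ 0)) `|`
      (I `&` s' @^-1` (range s' `\ 0))))).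
    apply: le_measure; rewrite ?inE//.
    - apply: measurableI; first exact: mI.
      exact: (finite_range_preimage_measurable [set q | q.1 + q.2 = x] fp mp).
    - by apply: measurableU; exact: mU.
  apply: (le_lt_trans (measureU2 _ _ _)); [exact: mU|exact: mU|].
  by apply: lte_add_pinfty; exact: fin.
split=> //.
rewrite (@simple_integral_refine _ _ (fun q => q.1 + q.2) (s + s') fp mp)//.
rewrite (@simple_integral_refine _ _ fst s fp mp)//.
rewrite (@simple_integral_refine _ _ snd s' fp mp)//.
rewrite !fsbig_finite//= -big_split/=; apply: eq_bigr => q _.
by rewrite scalerDr.
Qed.

End SimpleFunctions.

Section SimpleMap.
Context {R : realType}.
Local Notation mu := (@lebesgue_measure R).
Variables (I : set R) (mI : measurable I).
Context {E E' : completeNormedModType R[i]}.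

(** One statement for an arbitrary f fixing 0 and, when f is linear, for its
exchange with the integral. *)
Lemma simple_integrable_comp (f : E -> E') (s : {fimfun R >-> E}) :
  f 0 = 0 -> simple_integrable I s ->
  exists s' : {fimfun R >-> E'}, [/\ simple_integrable I s', s' = f \o s :> (R -> E') &
    ((forall (a : R[i]) x y, f (a *: x + y) = a *: f x + f y) ->
      simple_integral I s' = f (simple_integral I s))].
Proof.
move=> f0 is1; have [ms fs] := is1.
have is2 : simple_integrable I (f \o s : {fimfun R >-> E'}).
  split=> y.
    exact: (simple_preimage_measurable (f @^-1` [set y]) ms).
  move=> y0.
  have fin : finite_set (range s `&` f @^-1` [set y]) by exact: finite_setIl.
  have -> : I `&` (f \o s) @^-1` [set y] =
      \bigcup_(x in range s `&` f @^-1` [set y]) (I `&` s @^-1` [set x]).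
    apply/seteqP; split=> [t [It fy]|t [x [_ /= fxy] [It /= ->]]] //.
    by exists (s t) => //; split=> //; exists t.
  rewrite measure_fin_bigcup//; last 2 first.
  - exact: trivIset_level_sets.
  - by move=> q _; apply: measurableI; [exact: mI|exact: ms].
  rewrite fsbig_finite//= big_seq; apply: lte_sum_pinfty => x.
  rewrite in_fset_set// inE => -[_ /= fxy]; apply: fs.
  by apply: contra_neq y0 => x0; rewrite -fxy x0.
exists (f \o s); split=> // lf.
rewrite (simple_integral_refine mI (fimfunP s) ms (fun=> erefl) is2).
rewrite /simple_integral !fsbig_finite//=.
have fD x y : f (x + y) = f x + f y by rewrite -{1}(scale1r x) lf scale1r.
have fZ a x : f (a *: x) = a *: f x by rewrite -[a *: x]addr0 lf f0 addr0.
by elim/big_ind2 : _ => [|x a y b -> ->|x _]; rewrite ?f0 ?fD ?fZ.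
Qed.

End SimpleMap.

(** * Strong measurability *)

Section StrongMeasurability.
Context {R : realType}.
Local Notation mu := (@lebesgue_measure R).
Variables (I : set R) (mI : measurable I).

Lemma fimfun_of (E : Type) (f : R -> E) : finite_set (range f) ->
  exists s : {fimfun R >-> E}, s = f :> (R -> E).
Proof. by move=> ff; exists (fimfun_Sub (mem_set ff)). Qed.

(** The types T and U are arbitrary, so that a factor may be a boolean test or a
real simple function as well as a vector. *)
Lemma simple_map2 (T U : Type) (E : completeNormedModType R[i])
    (p : R -> T) (q : R -> U) (f : T -> U -> E) :
  finite_set (range p) -> (forall x, measurable (p @^-1` [set x])) ->
  finite_set (range q) -> (forall x, measurable (q @^-1` [set x])) ->
  exists s : {fimfun R >-> E}, simple s /\ forall t, s t = f (p t) (q t).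
Proof.
move=> fp mp fq mq.
have fpq := finite_range_pair fp fq.
have mpq z := measurable_preimage_pair z mp mq.
have [s sE] : exists s : {fimfun R >-> E}, s = (fun t => f (p t) (q t)) :> (R -> E).
  apply: fimfun_of; apply: sub_finite_set (finite_image (fun z => f z.1 z.2) fpq).
  by move=> _ [t _ <-]; exists (p t, q t) => //; exists t.
exists s; split=> [x|t]; last by rewrite sE.
by rewrite sE; exact: (finite_range_preimage_measurable [set z | f z.1 z.2 = x] fpq mpq).
Qed.

Lemma strongly_measurable_simple (E : completeNormedModType R[i])
  (s : {fimfun R >-> E}) : simple s -> strongly_measurable I s.
Proof. by move=> ms; exists (fun=> s); split=> // t _; exact: cvg_cst. Qed.

Lemma strongly_measurable_map2 (E F G : completeNormedModType R[i])
    (f : E -> F -> G) (u : R -> E) (v : R -> F) :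
  (forall (x : nat -> E) (y : nat -> F) a b, x n @[n --> \oo] --> a ->
    y n @[n --> \oo] --> b -> f (x n) (y n) @[n --> \oo] --> f a b) ->
  strongly_measurable I u -> strongly_measurable I v ->
  strongly_measurable I (fun t => f (u t) (v t)).
Proof.
move=> cf [s [ms su]] [r [mr rv]].
have /choice[h hP] : forall n, exists h : {fimfun R >-> G},
    simple h /\ forall t, h t = f (s n t) (r n t).
  by move=> n; apply: simple_map2 => //; [exact: ms|exact: mr].
exists h; split=> [n|t It]; first by case: (hP n).
under eq_fun do rewrite (hP _).2.
by apply: cf; [exact: su|exact: rv].
Qed.

Lemma strongly_measurableB (E : completeNormedModType R[i]) (u v : R -> E) :
  strongly_measurable I u -> strongly_measurable I v ->
  strongly_measurable I (fun t => u t - v t).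
Proof.
apply: (@strongly_measurable_map2 _ _ _ (fun x y => x - y)) => x y a b xa yb.
exact: cvgB.
Qed.

Lemma strongly_measurable_comp (E F : completeNormedModType R[i])
    (f : E -> F) (u : R -> E) :
  (forall (x : nat -> E) a, x n @[n --> \oo] --> a -> f (x n) @[n --> \oo] --> f a) ->
  strongly_measurable I u -> strongly_measurable I (f \o u).
Proof.
move=> cf mu_; apply: (@strongly_measurable_map2 _ _ _ (fun x (_ : E) => f x) u u) => //.
by move=> x y a b xa _; exact: cf.
Qed.

(** The approximations of phi are real-valued, hence outside the scope of
[strongly_measurable_map2], which is about vector-valued functions. *)
Lemma strongly_measurableZ (E : completeNormedModType R[i]) (phi : R -> R) (u : R -> E) :
  measurable_fun I phi -> strongly_measurable I u ->
  strongly_measurable I (fun t => (phi t)%:C *: u t).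
Proof.
move=> mphi [s [ms su]].
have /(approximation_sfun mI)[g gphi] : measurable_fun I (EFin \o phi).
  exact/measurable_EFinP.
have /choice[h hP] : forall n, exists h : {fimfun R >-> E},
    simple h /\ forall t, h t = (g n t)%:C *: s n t.
  move=> n; apply: (@simple_map2 _ _ _ _ _ (fun (a : R) (x : E) => a%:C *: x)) => //.
  exact: ms.
exists h; split=> [n|t It]; first by case: (hP n).
under eq_fun do rewrite (hP _).2.
apply: cvgZ; last exact: su.
apply/(@rnorm_cvg0P _ R[i]^o).
have gt : g n t @[n --> \oo] --> phi t.
  by have /fine_cvgP[_] := gphi t It.
under eq_fun do rewrite -rmorphB/= rnorm_real.
rewrite -(normr0 R) -(subrr (phi t)); apply: cvg_norm; apply: cvgB => //; exact: cvg_cst.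
Qed.

Lemma measurable_rnorm (E : completeNormedModType R[i]) (u : R -> E) :
  strongly_measurable I u -> measurable_fun I (fun t => (rnorm (u t))%:E).
Proof.
move=> [s [ms su]].
apply: (emeasurable_fun_cvg (fun n t => (rnorm (s n t))%:E)).
  by move=> n; exact: (measurable_fun_simple mI (@rnorm R E)).
move=> t It; apply/fine_cvgP; split; first exact: nearW.
by apply: cvg_rnorm; exact: su.
Qed.

End StrongMeasurability.

(** * The Bochner integral *)

Section BochnerTheory.
Context {R : realType}.
Local Notation mu := (@lebesgue_measure R).
Variables (I : set R) (mI : measurable I).

Definition L1norm (E : normedModType R[i]) (F : R -> E) : \bar R :=
  (\int[mu]_(t in I) (rnorm (F t))%:E)%E.

Lemma L1norm_ge0 (E : normedModType R[i]) (F : R -> E) : (0 <= L1norm F)%E.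
Proof. by apply: integral_ge0 => t _; rewrite lee_fin rnorm_ge0. Qed.

Lemma L1norm_leD (E F G : completeNormedModType R[i])
    (u : R -> E) (v : R -> F) (w : R -> G) :
  strongly_measurable I u -> strongly_measurable I v -> strongly_measurable I w ->
  (forall t, I t -> rnorm (u t) <= rnorm (v t) + rnorm (w t)) ->
  (L1norm u <= L1norm v + L1norm w)%E.
Proof.
move=> mu_ mv mw uvw; rewrite /L1norm -ge0_integralD; last 5 first.
- exact: mI.
- by move=> t _; rewrite lee_fin rnorm_ge0.
- exact: measurable_rnorm.
- by move=> t _; rewrite lee_fin rnorm_ge0.
- exact: measurable_rnorm.
apply: ge0_le_integral; first exact: mI.
- by move=> t _; rewrite lee_fin rnorm_ge0.
- exact: measurable_rnorm.
- by apply: emeasurable_funD; exact: measurable_rnorm.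
- by move=> t It; rewrite -EFinD lee_fin uvw.
Qed.

Lemma ecvg0_lt (u : nat -> \bar R) (e : R) : (u n @[n --> \oo] --> 0)%E -> 0 < e ->
  \forall n \near \oo, (u n < e%:E)%E.
Proof.
move=> /fine_cvgP[fu /cvgrPdist_lt cu] e0; near=> n.
have fn : u n \is a fin_num by near: n.
rewrite -(fineK fn) lte_fin; apply: (le_lt_trans (ler_norm _)).
rewrite -normrN -sub0r; near: n; exact: cu.
Unshelve. all: by end_near. Qed.

Lemma lt_ecvg0 (u : nat -> \bar R) : (forall n, 0 <= u n)%E ->
  (forall e : R, 0 < e -> \forall n \near \oo, (u n < e%:E)%E) ->
  (u n @[n --> \oo] --> 0)%E.
Proof.
move=> u0 ue; apply/fine_cvgP; split.
  apply: filterS (ue _ ltr01) => n un; rewrite ge0_fin_numE//.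
  by rewrite (lt_trans un)// ltry.
apply/cvgrPdist_lt => e e0; apply: filterS (ue _ e0) => n un /=.
have fn : u n \is a fin_num by rewrite ge0_fin_numE// (lt_trans un)// ltry.
by rewrite sub0r normrN ger0_norm ?fine_ge0// -lte_fin fineK.
Qed.

Section OneSpace.
Context {E : completeNormedModType R[i]}.
Implicit Types F : R -> E.

Lemma bochner_strongly_measurable F y :
  is_bochner_integral I F y -> strongly_measurable I F.
Proof. by case=> s [is_ sF _ _]; exists s; split=> // n; case: (is_ n). Qed.

Lemma simple_integral_dist (s r : {fimfun R >-> E}) :
  simple_integrable I s -> simple_integrable I r ->
  ((rnorm (simple_integral I s - simple_integral I r))%:E <=
    L1norm (fun t => s t - r t)%R)%E.
Proof.
move=> is_ ir.
have [r' [ir' r'E r'i]] := simple_integrable_comp mI (f := @GRing.opp E) (oppr0 _) ir.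
have [isr isrE] := simple_integrableD mI is_ ir'.
have <- : simple_integral I (s + r') = simple_integral I s - simple_integral I r.
  by rewrite isrE r'i// => a x z; rewrite opprD scalerN.
have -> : L1norm (fun t => s t - r t) = L1norm (s + r').
  by apply: eq_integral => t _; rewrite fimfunD /= r'E.
exact: simple_integral_le.
Qed.

(** The triangle inequality through F: integrals of good approximations of F are
close to each other, which serves both uniqueness and existence. *)
Lemma simple_integral_dist_via F (s r : {fimfun R >-> E}) :
  strongly_measurable I F -> simple_integrable I s -> simple_integrable I r ->
  ((rnorm (simple_integral I s - simple_integral I r))%:E <=
    L1norm (fun t => F t - s t)%R + L1norm (fun t => F t - r t)%R)%E.
Proof.
move=> mF is_ ir; have ms := strongly_measurable_simple I is_.1.
have mr := strongly_measurable_simple I ir.1.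
apply: (le_trans (simple_integral_dist is_ ir)).
apply: L1norm_leD; try exact: strongly_measurableB.
by move=> t _; rewrite (rdistC (F t) (s t)); exact: ler_rdistD.
Qed.

Lemma bochner_unique F y z :
  is_bochner_integral I F y -> is_bochner_integral I F z -> y = z.
Proof.
move=> iy iz; have mF := bochner_strongly_measurable iy.
case: iy => s [is_ _ sF sy]; case: iz => r [ir _ rF rz].
apply/eqP; rewrite -subr_eq0 -rnorm_eq0 eq_le rnorm_ge0 andbT.
apply/ler_addgt0Pl => e e0; rewrite addr0.
have e4 : 0 < e / 4 by rewrite divr_gt0.
have near_sr : \forall n \near \oo, rnorm (y - z) <= e.
  near=> n.
  have h : rnorm (simple_integral I (s n) - simple_integral I (r n)) <= e / 4 + e / 4.
    rewrite -lee_fin EFinD; apply: (le_trans (simple_integral_dist_via mF (is_ n) (ir n))).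
    by apply: leeD; apply/ltW; near: n; exact: ecvg0_lt.
  apply: (le_trans (ler_rdistD (simple_integral I (s n)) _ _)).
  apply: (@le_trans _ _ (e / 4 + ((e / 4 + e / 4) + e / 4))); last first.
    by rewrite le_eqVlt; apply/orP; left; apply/eqP; field.
  apply: lerD.
    by apply/ltW; near: n; move/rnorm_cvgP : sy; exact.
  apply: (le_trans (ler_rdistD (simple_integral I (r n)) _ _)); apply: lerD => //.
  by rewrite rdistC; apply/ltW; near: n; move/rnorm_cvgP : rz; exact.
by case: near_sr => N _ /(_ N); apply => /=.
Unshelve. all: by end_near. Qed.

Lemma bochner_integralE F y : is_bochner_integral I F y -> bochner_integral I F = y.
Proof.
move=> iy; apply: (bochner_unique _ iy).
exact: (xgetI 0 iy).
Qed.

Lemma rnorm_bochner_le F y : is_bochner_integral I F y ->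
  ((rnorm y)%:E <= L1norm F)%E.
Proof.
move=> iy; have mF := bochner_strongly_measurable iy.
case: iy => s [is_ _ sF sy].
apply/lee_addgt0Pr => e e0.
have e2 : 0 < e / 2 by rewrite divr_gt0.
have near_s : \forall n \near \oo, ((rnorm y)%:E <= L1norm F + e%:E)%E.
  near=> n; have ms := strongly_measurable_simple I (is_ n).1.
  rewrite [e]splitr EFinD addeA.
  apply: (@le_trans _ _ ((rnorm (simple_integral I (s n)))%:E + (e / 2)%:E))%E.
    rewrite -EFinD lee_fin addrC -lerBlDr.
    apply: (le_trans (ler_norm _)); apply: (le_trans (ler_rdist_dist _ _)).
    by apply/ltW; near: n; move/rnorm_cvgP : sy; exact.
  rewrite leeD2r//; apply: (le_trans (simple_integral_le mI (is_ n))).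
  apply: (@le_trans _ _ (L1norm F + L1norm (fun t => F t - s n t)%R))%E.
    apply: L1norm_leD => //; first exact: strongly_measurableB.
    move=> t _; rewrite -{1}(subrK (F t) (s n t)) addrC.
    by rewrite (rdistC (F t)) ler_rnormD.
  by rewrite leeD2l//; apply/ltW; near: n; exact: ecvg0_lt.
by case: near_s => N _ /(_ N); apply => /=.
Unshelve. all: by end_near. Qed.

End OneSpace.

(** Bounded linear maps send approximations of F to approximations of f o F. *)
Lemma bochner_map (E G : completeNormedModType R[i]) (f : E -> G) (C : R)
    (F : R -> E) y :
  (forall (a : R[i]) x z, f (a *: x + z) = a *: f x + f z) ->
  (forall x, rnorm (f x) <= C * rnorm x) ->
  is_bochner_integral I F y -> is_bochner_integral I (f \o F) (f y).
Proof.
move=> lf bf iy; have mF := bochner_strongly_measurable iy.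
have C0 : 0 <= `|C| by [].
have {}bf x : rnorm (f x) <= `|C| * rnorm x.
  by apply: (le_trans (bf x)); rewrite ler_wpM2r ?rnorm_ge0// ler_norm.
have f0 : f 0 = 0.
  by apply/eqP; rewrite -rnorm_eq0 eq_le rnorm_ge0 andbT (le_trans (bf 0))// rnorm0 mulr0.
have fB x z : f (x - z) = f x - f z by rewrite addrC -scaleN1r lf scaleN1r addrC.
have cf (T : Type) (V : set_system T) (FV : Filter V) (x : T -> E) a :
    x n @[n --> V] --> a -> f (x n) @[n --> V] --> f a.
  move=> /rnorm_cvg0P xa; apply: (@rnorm_cvg_le _ _ _ _ _ _ _ (fun n => `|C| * rnorm (a - x n))).
    by apply: nearW => n; rewrite -fB.
  by rewrite -(mulr0 `|C|); apply: cvgM => //; exact: cvg_cst.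
case: iy => s [is_ ss sF sy].
have /choice[r rP] n := simple_integrable_comp mI f0 (is_ n).
exists r; split.
- by move=> n; case: (rP n).
- move=> t It; have -> : r^~ t = (fun n => f (s n t)).
    by apply/funext => n; case: (rP n) => _ ->.
  by apply: cf; exact: ss.
- have mB n : strongly_measurable I (fun t => F t - s n t).
    by apply: strongly_measurableB => //; exact: strongly_measurable_simple (is_ n).1.
  apply: lt_ecvg0 => [n|e e0]; first exact: L1norm_ge0.
  have e1 : 0 < e / (`|C| + 1) by rewrite divr_gt0// ltr_wpDl.
  have := ecvg0_lt sF e1; apply: filterS => n sn.
  apply: (@le_lt_trans _ _ ((`|C| + 1)%:E * L1norm (fun t => F t - s n t)%R)%E).
    rewrite /L1norm -ge0_integralZl; last 4 first.
    - exact: mI.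
    - exact: measurable_rnorm.
    - by move=> t _; rewrite lee_fin rnorm_ge0.
    - by rewrite lee_fin addr_ge0.
    apply: ge0_le_integral; first exact: mI.
    - by move=> t _; rewrite lee_fin rnorm_ge0.
    - apply: (@measurable_rnorm _ _ mI); apply: strongly_measurableB.
        by apply: strongly_measurable_comp => // x a; exact: cf.
      by apply: strongly_measurable_simple; case: (rP n) => -[].
    - apply: measurable_funeM; exact: measurable_rnorm.
    - move=> t It; rewrite -EFinM lee_fin; case: (rP n) => _ -> _ /=.
      rewrite -fB (le_trans (bf _))// ler_wpM2r ?rnorm_ge0//.
      by rewrite lerDl.
  rewrite muleC -lte_pdivlMr// ?EFinN ?ltr_wpDl//.
- have -> : (fun n => simple_integral I (r n)) = (fun n => f (simple_integral I (s n))).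
    by apply/funext => n; case: (rP n) => _ _ ->.
  exact: cf.
Qed.

Lemma bochnerD (E : completeNormedModType R[i]) (F G : R -> E) y z :
  is_bochner_integral I F y -> is_bochner_integral I G z ->
  is_bochner_integral I (fun t => F t + G t) (y + z).
Proof.
move=> iy iz; have mF := bochner_strongly_measurable iy.
have mG := bochner_strongly_measurable iz.
case: iy => s [is_ ss sF sy]; case: iz => r [ir rr rG rz].
have isr n := simple_integrableD mI (is_ n) (ir n).
have mFs n : strongly_measurable I (fun t => F t - s n t).
  by apply: strongly_measurableB => //; exact: strongly_measurable_simple (is_ n).1.
have mGr n : strongly_measurable I (fun t => G t - r n t).
  by apply: strongly_measurableB => //; exact: strongly_measurable_simple (ir n).1.
exists (fun n => s n + r n); split.
- by move=> n; case: (isr n).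
- by move=> t It; apply: cvgD; [exact: ss|exact: rr].
- apply: lt_ecvg0 => [n|e e0]; first exact: L1norm_ge0.
  have e2 : 0 < e / 2 by rewrite divr_gt0.
  near=> n; apply: (@le_lt_trans _ _
      (L1norm (fun t => F t - s n t)%R + L1norm (fun t => G t - r n t)%R)%E).
    apply: L1norm_leD => //; last first.
      by move=> t _; rewrite fimfunD/= opprD addrACA ler_rnormD.
    apply: strongly_measurableB; last exact: strongly_measurable_simple (isr n).1.1.
    apply: (@strongly_measurable_map2 _ _ _ _ _ (fun x y => x + y)) => // x x' a b xa xb.
    exact: cvgD.
  rewrite [e]splitr EFinD; apply: lteD; near: n; exact: ecvg0_lt.
- under eq_fun do rewrite (isr _).2.
  exact: cvgD.
Unshelve. all: by end_near. Qed.

End BochnerTheory.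

Section BochnerExistence.
Context {R : realType}.
Local Notation mu := (@lebesgue_measure R).
Variables (I : set R) (mI : measurable I).
Context {E : completeNormedModType R[i]}.

Lemma pmule_lt_pinfty (a : R) (x : \bar R) : 0 < a -> (0 <= x)%E ->
  (a%:E * x < +oo)%E -> (x < +oo)%E.
Proof.
move=> a0; case: x => [x _ _|_|//]; first exact: ltry.
by rewrite gt0_muley ?lte_fin.
Qed.

Lemma measurable_markov (F : R -> E) (a : R) : strongly_measurable I F -> 0 < a ->
  (L1norm I F < +oo)%E -> (mu (I `&` [set t | (a <= rnorm (F t))%R]) < +oo)%E.
Proof.
move=> mF a0 fF; have := le_integral_abse mu mI (measurable_rnorm mI mF) a0.
rewrite (_ : I `&` [set t | (a%:E <= `|(rnorm (F t))%:E|)%E] =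
    I `&` [set t | a <= rnorm (F t)]); last first.
  by congr (_ `&` _); apply/seteqP; split=> t /=; rewrite lee_fin ger0_norm ?rnorm_ge0.
rewrite (_ : (\int[mu]_(x in I) `|(rnorm (F x))%:E|)%E = L1norm I F); last first.
  by apply: eq_integral => t _; rewrite gee0_abs// lee_fin rnorm_ge0.
move=> /le_lt_trans/(_ fF) h.
exact: (pmule_lt_pinfty a0 (measure_ge0 _ _) h).
Qed.

(** The approximating functions are cut to 0 where their norm exceeds twice that
of F.  This does not affect the limit: where F = 0 the truncation is 0, and
elsewhere it is eventually inactive.  It makes the sequence dominated, and each
function is nonzero only on a set of finite measure, by Markov's inequality. *)
Lemma truncated_approximation (F : R -> E) : strongly_measurable I F ->
  (L1norm I F < +oo)%E -> exists h : nat -> {fimfun R >-> E},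
  [/\ forall n, simple_integrable I (h n),
      forall t, I t -> h n t @[n --> \oo] --> F t &
      forall n t, I t -> rnorm (h n t) <= 2 * rnorm (F t)].
Proof.
move=> mF fF; have [s [ms sF]] := mF.
pose B n := I `&` [set t | ((rnorm (s n t) - 2 * rnorm (F t))%:E <= 0%:E)%E].
have mB n : measurable (B n).
  apply: emeasurable_fun_infty_c => //; apply/measurable_EFinP.
  apply: measurable_funB.
    by apply/measurable_EFinP; exact: (measurable_fun_simple mI (@rnorm R E)).
  apply: measurable_funM; first exact: measurable_cst.
  by apply/measurable_EFinP; exact: measurable_rnorm.
have /choice[h hP] : forall n, exists h : {fimfun R >-> E}, simple h /\
    forall t, h t = if t \in B n then s n t else 0.
  move=> n; apply: (@simple_map2 _ _ _ _ (s n) (fun t => t \in B n)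
      (fun x (b : bool) => if b then x else 0)).
  - exact: fimfunP.
  - exact: ms.
  - exact: finite_finset.
  - move=> b; have -> : (fun t => t \in B n) @^-1` [set b] = if b then B n else ~` B n.
      case: b; apply/seteqP; split=> t /=; first by move/set_mem.
      - by move=> ?; exact/mem_set.
      - by move/negbT/negP => + Bt; apply; exact/mem_set.
      - by move=> nB; apply/negbTE/negP => /set_mem.
    by case: b => //; exact: measurableC.
have hF n t : I t -> rnorm (h n t) <= 2 * rnorm (F t).
  move=> It; rewrite (hP n).2; case: ifPn => [|_].
    by move=> /set_mem [_ /=]; rewrite lee_fin subr_le0.
  by rewrite rnorm0 mulr_ge0// rnorm_ge0.
exists h; split=> //.
- move=> n; split; first by case: (hP n).
  move=> x x0; have x0' : 0 < rnorm x / 2.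
    by rewrite divr_gt0// lt_neqAle rnorm_ge0 eq_sym rnorm_eq0 x0.
  apply: le_lt_trans (measurable_markov mF x0' fF).
  apply: le_measure; rewrite ?inE.
  - by apply: measurableI; [exact: mI|exact: (hP n).1].
  - have := emeasurable_fun_c_infty mI (measurable_rnorm mI mF) (rnorm x / 2)%:E.
    by congr (measurable (_ `&` _)).
  - move=> t [It /= ht]; split=> //=.
    by rewrite ler_pdivrMr// mulrC -ht hF.
- move=> t It; have [F0|F0] := eqVneq (F t) 0.
    rewrite (_ : h^~ t = fun=> F t); first exact: cvg_cst.
    apply/funext => n; apply/eqP; rewrite F0 -rnorm_eq0 eq_le rnorm_ge0 andbT.
    by rewrite (le_trans (hF n t It))// F0 rnorm0 mulr0.
  have Fp : 0 < rnorm (F t) by rewrite lt_neqAle rnorm_ge0 eq_sym rnorm_eq0 F0.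
  apply/rnorm_cvgP => e e0.
  have /rnorm_cvgP sFt := sF t It.
  near=> n.
  rewrite (hP n).2 mem_set; first by near: n; exact: sFt.
  split=> //=; rewrite lee_fin subr_le0 mulr2n mulrDl mul1r.
  rewrite -[s n t](subrK (F t)); apply: (le_trans (ler_rnormD _ _)).
  by rewrite lerD2r rdistC; apply/ltW; near: n; exact: sFt.
Unshelve. all: by end_near. Qed.

(** By dominated convergence the truncated approximations tend to F in L^1, so
their integrals form a Cauchy sequence. *)
Lemma bochner_exists (F : R -> E) : strongly_measurable I F ->
  (L1norm I F < +oo)%E -> exists y, is_bochner_integral I F y.
Proof.
move=> mF fF; have [h [ih hF h2]] := truncated_approximation mF fF.
have mFh n : strongly_measurable I (fun t => F t - h n t).
  by apply: strongly_measurableB => //; exact: strongly_measurable_simple (ih n).1.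
have h3 n t : I t -> rnorm (F t - h n t) <= 3 * rnorm (F t).
  move=> It; apply: (le_trans (ler_rnormB _ _)).
  by have := h2 n t It; lra.
have int3 : mu.-integrable I (fun t => (3 * rnorm (F t))%:E).
  apply/integrableP; split.
    apply/measurable_EFinP; apply: measurable_funM; first exact: measurable_cst.
    by apply/measurable_EFinP; exact: measurable_rnorm.
  have -> : (\int[mu]_(t in I) `|(3 * rnorm (F t))%R%:E| =
      \int[mu]_(t in I) (3%:E * (rnorm (F t))%:E))%E.
    by apply: eq_integral => t _; rewrite gee0_abs ?EFinM// lee_fin mulr_ge0// rnorm_ge0.
  rewrite (_ : integral _ _ _ = (3%:E * L1norm I F)%E); last first.
    apply: ge0_integralZl; [exact: mI|exact: measurable_rnorm| |by rewrite lee_fin].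
    by move=> t _; rewrite lee_fin rnorm_ge0.
  by rewrite lte_mul_pinfty// lee_fin.
have h0 : (L1norm I (fun t => F t - h n t)%R @[n --> \oo] --> 0)%E.
  have [|||||_ _] := @dominated_convergence _ _ _ mu I mI
      (fun n t => (rnorm (F t - h n t))%:E) (cst 0%E) (fun t => (3 * rnorm (F t))%:E).
  - by move=> n; exact: measurable_rnorm.
  - exact: measurable_cst.
  - apply: aeW => t It; apply/fine_cvgP; split; first exact: nearW.
    by apply/rnorm_cvg0P; exact: hF.
  - exact: int3.
  - apply: aeW => t n It; rewrite gee0_abs ?lee_fin ?rnorm_ge0//.
    exact: h3.
  by rewrite integral0.
pose d n := fine (L1norm I (fun t => F t - h n t)).
have fd n : L1norm I (fun t => F t - h n t) \is a fin_num.
  rewrite ge0_fin_numE ?L1norm_ge0//.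
  have /integrableP[_] := int3; apply: le_lt_trans.
  apply: ge0_le_integral; first exact: mI.
  - by move=> t _; rewrite lee_fin rnorm_ge0.
  - exact: measurable_rnorm.
  - apply: measurableT_comp => //.
    by have /integrableP[] := int3.
  - by move=> t It; rewrite gee0_abs ?lee_fin ?h3// mulr_ge0// rnorm_ge0.
have [y hy] : exists y : E, simple_integral I (h n) @[n --> \oo] --> y.
  apply: (@dominated_cauchy_cvg _ _ _ d).
    move=> m n; rewrite -lee_fin EFinD !fineK//.
    exact: simple_integral_dist_via.
  by have /fine_cvgP[_] := h0.
by exists y, h.
Qed.

Lemma ae_lebesgueS (P Q : R -> Prop) : (forall t, P t -> Q t) ->
  {ae mu, forall t, P t} -> {ae mu, forall t, Q t}.
Proof.
move=> PQ [N [mN N0 sN]]; exists N; split=> // t nQ.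
by apply: sN => Pt; apply: nQ; exact: PQ.
Qed.

(** The bound is only required almost everywhere, since an element of L^2 agrees
only almost everywhere with its continuous representative. *)
Lemma rnorm_bochner_ae_le (F : R -> E) y (phi : R -> R) : is_bochner_integral I F y ->
  measurable_fun I (fun t => (phi t)%:E) -> (forall t, 0 <= phi t) ->
  {ae mu, forall t, I t -> rnorm (F t) <= phi t} ->
  ((rnorm y)%:E <= \int[mu]_(t in I) (phi t)%:E)%E.
Proof.
move=> iy mphi phi0 Fphi; apply: (le_trans (rnorm_bochner_le mI iy)).
apply: ae_ge0_le_integral; first exact: mI.
- by move=> t _; rewrite lee_fin rnorm_ge0.
- apply: measurable_rnorm => //; exact: bochner_strongly_measurable iy.
- by move=> t _; rewrite lee_fin.
- exact: mphi.
- by apply: ae_lebesgueS Fphi => t Ft It; rewrite lee_fin Ft.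
Qed.

Lemma bochner_indic (J : set R) (c : E) : measurable J -> J `<=` I ->
  (mu J < +oo)%E ->
  is_bochner_integral I (fun t => if t \in J then c else 0) ((fine (mu J))%:C *: c).
Proof.
move=> mJ JI fJ.
have [s [ms sE]] : exists s : {fimfun R >-> E}, simple s /\
    forall t, s t = if t \in J then c else 0.
  apply: (@simple_map2 _ _ _ _ (fun=> tt) (fun t => t \in J)
      (fun _ (b : bool) => if b then c else 0)).
  - exact: finite_finset.
  - move=> -[]; have -> : (fun=> tt) @^-1` [set tt] = [set: R].
      by apply/seteqP; split.
    exact: measurableT.
  - exact: finite_finset.
  - move=> b; have -> : (fun t => t \in J) @^-1` [set b] = if b then J else ~` J.
      case: b; apply/seteqP; split=> t /=; first by move/set_mem.
      - by move=> ?; exact/mem_set.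
      - by move/negbT/negP => + Bt; apply; exact/mem_set.
      - by move=> nB; apply/negbTE/negP => /set_mem.
    by case: b => //; exact: measurableC.
have sc : c != 0 -> I `&` s @^-1` [set c] = J.
  move=> c0; apply/seteqP; split=> [t [It /=]|t Jt]; last first.
    by split; [exact: JI|rewrite /= sE mem_set].
  rewrite sE; case: ifPn => [/set_mem//|_ c0'].
  by rewrite -c0' eqxx in c0.
have is_ : simple_integrable I s.
  split=> // x x0; have [xc|xc] := eqVneq x c; first by rewrite xc sc// -xc.
  have -> : I `&` s @^-1` [set x] = set0.
    apply/seteqP; split=> // t [It /=]; rewrite sE; case: ifPn => _ h.
      by rewrite h eqxx in xc.
    by rewrite h eqxx in x0.
  by rewrite measure0.
exists (fun=> s); split=> //.
- by move=> t It; rewrite sE; exact: cvg_cst.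
- under eq_fun do (under eq_integral do rewrite sE subrr rnorm0).
  rewrite integral0; exact: cvg_cst.
have [c0|c0] := eqVneq c 0.
  rewrite c0 scaler0; suff -> : simple_integral I s = 0 by exact: cvg_cst.
  apply/eqP; rewrite -rnorm_eq0 eq_le rnorm_ge0 andbT -lee_fin.
  apply: (le_trans (simple_integral_le mI is_)).
  rewrite (eq_integral (cst 0%E)) ?integral0// => t _.
  by rewrite sE c0 if_same rnorm0.
suff -> : simple_integral I s = (fine (mu J))%:C *: c by exact: cvg_cst.
rewrite /simple_integral (fsbig_fwiden [:: c; 0]).
- by rewrite !big_cons big_nil /= scaler0 !addr0 sc.
- move=> _ [t _ <-] /=; rewrite sE !inE; case: ifPn => _; rewrite eqxx ?orbT//.
- by rewrite /= inE c0.
- move=> x [/= _ nx]; have -> : s @^-1` [set x] = set0.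
    by apply/seteqP; split=> // t /= tx; apply: nx; exists t.
  by rewrite setI0 measure0 /= scale0r.
Qed.

End BochnerExistence.

(** * Smooth bumps *)

Section SmoothFunctions.
Context {R : realType}.
Implicit Types f g : R -> R.

(** Error bounds of second order are what Taylor's formula and the decay of
exp(-1/x) at 0 provide. *)
Lemma is_derive_quadratic f (x d C delta : R) : 0 < delta ->
  (forall h, `|h| < delta -> `|f (x + h) - f x - h * d| <= C * h ^+ 2) ->
  is_derive x 1 f d.
Proof.
move=> delta0 fC.
have key : h^-1 *: ((f \o shift x) (h *: 1) - f x) @[h --> 0^'] --> d.
  apply/cvgrPdist_lt => e e0; near=> h.
  have h0 : h != 0 by near: h; exact: nbhs_dnbhs_neq.
  have hd : `|h| < delta by near: h; apply: dnbhs0_lt.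
  have he : `|h| < e / (`|C| + 1).
    by near: h; apply: dnbhs0_lt; rewrite divr_gt0// ltr_wpDl.
  rewrite /= [h *: 1]mulr1 (addrC h x).
  have -> : d - h^-1 *: (f (x + h) - f x) = - (h^-1 * (f (x + h) - f x - h * d)).
    by rewrite /GRing.scale/=; field.
  rewrite normrN normrM normfV; apply: (@le_lt_trans _ _ (`|h|^-1 * (C * h ^+ 2))).
    by rewrite ler_pM2l ?invr_gt0 ?normr_gt0//; exact: fC.
  rewrite -(real_normK (num_real h)) mulrCA expr2 mulKf ?normr_eq0//.
  apply: (@le_lt_trans _ _ ((`|C| + 1) * `|h|)).
    by rewrite ler_wpM2r// (le_trans (ler_norm _))// lerDl.
  by rewrite mulrC -ltr_pdivlMr ?ltr_wpDl.
have dfx : derivable f x 1 by apply/cvg_ex; exists d.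
by apply: DeriveDef => //; exact/cvg_lim.
Unshelve. all: by end_near. Qed.

(** Counting derivatives from the first one on, whereas [smooth] iterates from
the last: products and compositions are then handled by induction on n. *)
Fixpoint times_derivable n f : Prop :=
  if n is m.+1 then (forall t, derivable f t 1) /\ times_derivable m (derive1 f) else True.

Lemma smoothP f : smooth f <-> forall n, times_derivable n f.
Proof.
split=> [+ n|].
  elim: n f => [//|n IHn] f sf; split=> [t|]; first exact: (sf 0%N).
  by apply: IHn => m t; rewrite -derive1Sn; exact: sf.
move=> tf n; elim: n f tf => [|n IHn] f tf t; first by have [/(_ t)] := tf 1%N.
by rewrite derive1Sn; apply: IHn => m; have [] := tf m.+1.
Qed.

Lemma times_derivableW n f : times_derivable n.+1 f -> times_derivable n f.
Proof.
elim: n f => [//|n IHn] f [df tf]; split=> //.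
exact: IHn.
Qed.

Lemma derive1_is_derive f f' : (forall t : R, is_derive t (1 : R) f (f' t)) -> derive1 f = f'.
Proof. by move=> df; apply/funext => t; rewrite derive1E (@derive_val _ _ _ _ _ _ _ (df t)). Qed.

Lemma derivable_is_derive f t : derivable f t 1 -> is_derive t 1 f (derive1 f t).
Proof. by move=> df; rewrite derive1E; exact: derivableP. Qed.

Lemma times_derivableD n f g : times_derivable n f -> times_derivable n g ->
  times_derivable n (f + g).
Proof.
elim: n f g => [//|n IHn] f g [df tf] [dg tg].
have dfg (t : R) : is_derive t (1 : R) (f + g) ((derive1 f + derive1 g) t).
  by apply: is_deriveD; exact: derivable_is_derive.
split=> [t|]; first exact: (@ex_derive _ _ _ _ _ _ _ (dfg t)).
by rewrite (derive1_is_derive dfg); exact: IHn.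
Qed.

Lemma times_derivableM n f g : times_derivable n f -> times_derivable n g ->
  times_derivable n (f * g).
Proof.
elim: n f g => [//|n IHn] f g tf tg; have [df tf'] := tf; have [dg tg'] := tg.
have dfg (t : R) : is_derive t (1 : R) (f * g) ((f * derive1 g + g * derive1 f) t).
  by apply: is_deriveM; exact: derivable_is_derive.
split=> [t|]; first exact: (@ex_derive _ _ _ _ _ _ _ (dfg t)).
rewrite (derive1_is_derive dfg); apply: times_derivableD; apply: IHn => //.
  exact: times_derivableW.
exact: times_derivableW.
Qed.

Lemma times_derivable_cst n (c : R) : times_derivable n (cst c).
Proof.
elim: n c => [//|n IHn] c; split=> [t|]; first exact: derivable_cst.
by rewrite (@derive1_is_derive _ (cst 0))// => t; exact: is_derive_cst.
Qed.

Lemma is_derive_affine f (a b d : R) t : is_derive (a * t + b) 1 f d ->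
  is_derive t 1 (fun t => f (a * t + b)) (d * a).
Proof.
move=> df; have daff : is_derive t (1 : R) (fun t => a * t + b) a.
  apply: (@is_derive_quadratic _ _ _ 0 1) => // h _.
  by rewrite mul0r normr_le0; apply/eqP; ring.
exact: (@is_derive1_comp _ f (fun t => a * t + b)).
Qed.

Lemma times_derivable_affine n f (a b : R) : times_derivable n f ->
  times_derivable n (fun t => f (a * t + b)).
Proof.
elim: n f => [//|n IHn] f [df tf].
have dfa (t : R) : is_derive t (1 : R) (fun t => f (a * t + b)) (((fun t => derive1 f (a * t + b)) * cst a) t).
  by apply: is_derive_affine; exact: derivable_is_derive.
split=> [t|]; first exact: (@ex_derive _ _ _ _ _ _ _ (dfa t)).
rewrite (derive1_is_derive dfa); apply: times_derivableM; first exact: IHn.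
exact: times_derivable_cst.
Qed.

(** The function p(1/x) exp(-1/x), extended by 0 to the left of 0.  This family is
closed under differentiation. *)
Definition flat (p : {poly R}) (x : R) : R :=
  if 0 < x then p.[x^-1] * expR (- x^-1) else 0.

(** The derivative of p(1/x) exp(-1/x) is q(1/x) exp(-1/x) with q = X^2 (p - p'). *)
Definition flat_deriv (p : {poly R}) : {poly R} := 'X ^+ 2 * (p - p^`()).

(** Coefficientwise, since y^i <= i! exp(y). *)
Lemma poly_le_expR (p : {poly R}) : exists C : R,
  forall y : R, 0 <= y -> `|p.[y]| <= C * expR y.
Proof.
exists (\sum_(i < size p) `|p`_i| * (i`!)%:R) => y y0.
rewrite horner_coef mulr_suml; apply: (le_trans (ler_norm_sum _ _ _)).
apply: ler_sum => i _; rewrite normrM -mulrA ler_wpM2l//.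
rewrite ger0_norm ?exprn_ge0// mulrC -ler_pdivrMr ?ltr0n ?fact_gt0//.
case: (i : nat) => [|n].
  by rewrite expr0 fact0 divr1 -expR0 ler_expR.
by apply: le_trans (expR_ge1Dxn n y0); rewrite lerDr.
Qed.

(** At 0 the difference quotient is controlled by [poly_le_expR] for X^2 p at
y = 1/h. *)
Lemma is_derive_flat p (x : R) : is_derive x (1 : R) (flat p) (flat (flat_deriv p) x).
Proof.
have [x0|x0|->] := ltgtP x 0.
- have -> : flat (flat_deriv p) x = 0 by rewrite /flat ltNge (ltW x0).
  apply: (@near_eq_is_derive _ _ _ (cst 0)).
  near=> t; rewrite /flat ltNge ltW//; near: t; exact: lt_nbhsl.
- have -> : flat (flat_deriv p) x = (flat_deriv p).[x^-1] * expR (- x^-1).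
    by rewrite /flat x0.
  pose F : R -> R := (fun t : R => p.[t^-1]) * (fun t => expR (- t^-1)).
  have dF : is_derive x (1 : R) F ((flat_deriv p).[x^-1] * expR (- x^-1)).
    have dV : is_derive x (1 : R) (fun t : R => t^-1) (- x ^- 2).
      apply: is_derive_eq; first by apply: is_deriveV; rewrite gt_eqF.
      by rewrite /GRing.scale/= mulr1.
    have dp : is_derive x (1 : R) (fun t : R => p.[t^-1]) (p^`().[x^-1] * - x ^- 2).
      by apply: (@is_derive1_comp _ (horner p) (fun t => t^-1)).
    have dN : is_derive x (1 : R) (fun t : R => - t^-1) (x ^- 2).
      by rewrite -[x ^- 2]opprK; exact: is_deriveN.
    have de : is_derive x (1 : R) (fun t : R => expR (- t^-1)) (expR (- x^-1) * x ^- 2).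
      by apply: (@is_derive1_comp _ expR (fun t => - t^-1)).
    apply: (is_derive_eq (is_deriveM dp de)).
    rewrite /flat_deriv !hornerE /GRing.scale/= -exprVn; ring.
  apply: (@near_eq_is_derive _ _ _ F) => //.
  near=> t; rewrite /flat ifT//; near: t; exact: lt_nbhsr.
- have -> : flat (flat_deriv p) 0 = 0 by rewrite /flat ltxx.
  have [C hC] := poly_le_expR ('X ^+ 2 * p).
  apply: (@is_derive_quadratic _ _ _ C 1) => // h _.
  rewrite add0r mulr0 subr0 /flat ltxx subr0.
  have C0 : 0 <= C.
    by have := hC 0 (lexx _); rewrite expR0 mulr1; apply: le_trans.
  case: ifPn => [h0|_]; last by rewrite normr0 mulr_ge0// sqr_ge0.
  have hi : 0 <= h^-1 by rewrite invr_ge0 ltW.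
  have hh := hC _ hi; rewrite !hornerE/= normrM (ger0_norm (sqr_ge0 h^-1)) in hh.
  rewrite normrM (gtr0_norm (expR_gt0 _)) expRN ler_pdivrMr ?expR_gt0//.
  rewrite -mulrA (mulrC (h ^+ 2)) mulrA -ler_pdivrMr ?exprn_gt0//.
  by rewrite mulrC -exprVn.
Unshelve. all: by end_near. Qed.

Lemma times_derivable_flat n p : times_derivable n (flat p).
Proof.
elim: n p => [//|n IHn] p.
split=> [t|]; first exact: (@ex_derive _ _ _ _ _ _ _ (is_derive_flat p t)).
by rewrite (derive1_is_derive (is_derive_flat p)); exact: IHn.
Qed.

(** The product of exp(-1/t) and exp(-1/(e - t)), each cut to 0 where its argument
is not positive. *)
Lemma bump_exists (e : R) : 0 < e -> exists g : R -> R,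
  [/\ smooth g, forall t, 0 <= g t, forall t, ~~ (0 <= t <= e) -> g t = 0 &
      forall t, 0 < t < e -> 0 < g t].
Proof.
move=> e0; pose g : R -> R := flat 1 * (fun t => flat 1 (-1 * t + e)).
have gE t : g t = flat 1 t * flat 1 (e - t).
  by rewrite (addrC e) -(mulN1r t).
have flat0 t : 0 <= flat 1 t.
  by rewrite /flat; case: ifPn => // _; rewrite hornerE mul1r expR_ge0.
exists g; split.
- apply/smoothP => n; apply: times_derivableM; first exact: times_derivable_flat.
  by apply: times_derivable_affine; exact: times_derivable_flat.
- by move=> t; rewrite gE mulr_ge0.
- move=> t; rewrite negb_and -!ltNge => te; rewrite gE /flat.
  case/orP: te => te; first by rewrite ltNge (ltW te)/= mul0r.
  by rewrite subr_gt0 (ltNge t) (ltW te)/= mulr0.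
- move=> t /andP[t0 te]; rewrite gE /flat t0 subr_gt0 te.
  have one y : (1 : {poly R}).[y] = 1 by rewrite hornerE.
  by rewrite !one !mul1r mulr_gt0// expR_gt0.
Qed.

End SmoothFunctions.

Section Taylor.
Context {R : realType}.
Implicit Types f : R -> R.

Definition supported (a b : R) f := forall t, ~~ (a <= t <= b) -> f t = 0.

Lemma smooth_derive1 f : smooth f -> smooth (derive1 f).
Proof. by move=> sf n t; rewrite -derive1Sn; exact: sf. Qed.

Lemma smooth_is_derive f (t : R) : smooth f -> is_derive t (1 : R) f (derive1 f t).
Proof. by move=> sf; apply: derivable_is_derive; exact: (sf 0%N). Qed.

Lemma smooth_continuous f : smooth f -> continuous f.
Proof.
move=> sf t; apply: differentiable_continuous; apply/derivable1_diffP.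
exact: (sf 0%N).
Qed.

Lemma supported_derive1 (a b : R) f : supported a b f -> supported a b (derive1 f).
Proof.
move=> fab t tab; rewrite derive1E.
rewrite (@near_eq_derive _ _ _ _ (cst 0)); first exact: derive_cst.
move: tab; rewrite negb_and -!ltNge => /orP[ta|bt].
  near=> x; apply: fab; rewrite negb_and -!ltNge; apply/orP; left.
  by near: x; exact: lt_nbhsl.
near=> x; apply: fab; rewrite negb_and -!ltNge; apply/orP; right.
by near: x; exact: lt_nbhsr.
Unshelve. all: by end_near. Qed.

Lemma supported_bounded (a b : R) f : a <= b -> continuous f -> supported a b f ->
  exists M : R, forall t, `|f t| <= M.
Proof.
move=> ab cf fab.
have cn : {within `[a, b], continuous (fun t => `|f t|)}.
  apply: continuous_subspaceT => t; apply: continuous_comp; first exact: cf.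
  exact: norm_continuous.
have [c _ cmax] := EVT_max ab cn.
exists `|f c| => t; have [tab|tab] := boolP (a <= t <= b).
  by apply: cmax; rewrite in_itv.
by rewrite fab// normr0.
Qed.

Lemma smooth_mvt f x h : smooth f ->
  exists2 y, `|y - x| <= `|h| & f (x + h) - f x = h * derive1 f y.
Proof.
move=> sf.
have cf A : {within A, continuous f}.
  by apply: continuous_subspaceT; exact: smooth_continuous.
have [h0|h0] := leP 0 h.
  have xh : x <= x + h by rewrite lerDl.
  have [y yx ->] := MVT_segment xh (fun t _ => smooth_is_derive t sf) (cf _).
  exists y; last by rewrite mulrC addrAC subrr add0r.
  move: yx; rewrite in_itv/= => /andP[xy yxh].
  by rewrite !ger0_norm ?subr_ge0// lerBlDl.
have xh : x + h <= x by rewrite gerDl ltW.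
have [y yx e] := MVT_segment xh (fun t _ => smooth_is_derive t sf) (cf _).
exists y; last by rewrite -opprB e; ring.
move: yx; rewrite in_itv/= => /andP[xy yxh].
by rewrite ler0_norm ?subr_le0// ltr0_norm// lerN2 lerBrDl.
Qed.

(** Two uses of the mean value theorem: f (x + h) - f x = h f'(y), and then f'(y)
- f'(x) is at most M |h|. *)
Lemma smooth_taylor1 f (M : R) x h : smooth f ->
  (forall t, `|derive1 (derive1 f) t| <= M) ->
  `|f (x + h) - f x - h * derive1 f x| <= M * h ^+ 2.
Proof.
move=> sf fM; have [y yx ->] := smooth_mvt x h sf.
have [z _] := smooth_mvt x (y - x) (smooth_derive1 sf).
rewrite (addrC x (y - x)) subrK => e.
rewrite -mulrBr e !normrM -(real_normK (num_real h)) expr2.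
rewrite [leRHS]mulrCA ler_wpM2l// mulrC; apply: ler_pM => //.
Qed.

End Taylor.

Section Translation.
Context {R : realType}.

Definition translate (g : R -> R) (s : R) : R -> R := fun t => g (t - s).

Lemma translateE (g : R -> R) s : translate g s = (fun t => g (1 * t + (- s))).
Proof. by apply/funext => t; rewrite mul1r. Qed.

Lemma smooth_translate (g : R -> R) s : smooth g -> smooth (translate g s).
Proof.
move=> sg; rewrite translateE; apply/smoothP => n.
by apply: times_derivable_affine; move/smoothP : sg; exact.
Qed.

Lemma derive1_translate (g : R -> R) s : smooth g ->
  derive1 (translate g s) = translate (derive1 g) s.
Proof.
move=> sg; rewrite !translateE; apply: derive1_is_derive => t.
rewrite -[X in is_derive _ _ _ X]mulr1; apply: is_derive_affine.
exact: smooth_is_derive.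
Qed.

Lemma supported_translate (g : R -> R) (a b s : R) : supported a b g ->
  supported (a + s) (b + s) (translate g s).
Proof.
by move=> gab t ts; apply: gab; rewrite lerBrDr lerBlDr.
Qed.

Lemma smooth_measurable (g : R -> R) : smooth g -> measurable_fun setT g.
Proof. by move=> /smooth_continuous; exact: continuous_measurable_fun. Qed.

Lemma supported_le_indic (g : R -> R) (a b c d M : R) : supported a b g ->
  c <= a -> b <= d -> (forall t, `|g t| <= M) ->
  forall t, `|g t| <= M * \1_(`[c, d]%classic) t.
Proof.
move=> gab ca bd gM t; rewrite indicE; have [tab|tab] := boolP (a <= t <= b).
  rewrite mem_set ?mulr1//= in_itv/=; case/andP: tab => at_ tb.
  by rewrite (le_trans ca at_) (le_trans tb bd).
rewrite gab// normr0 mulr_ge0//.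
exact: le_trans (gM t).
Qed.

End Translation.


Section Mass.
Context {R : realType}.
Local Notation mu := (@lebesgue_measure R).
Variables (g : R -> R) (e : R).
Hypotheses (e0 : 0 < e) (sg : smooth g) (gs : supported 0 e g).
Hypotheses (g_ge0 : forall t, 0 <= g t) (g_gt0 : forall t, 0 < t < e -> 0 < g t).

Definition mass : R := fine (\int[mu]_(t in `[0%R, e]) (g t)%:E).

Lemma smooth_measurable_EFin (D : set R) (f : R -> R) : smooth f ->
  measurable_fun D (fun t => (f t)%:E).
Proof.
by move=> sf; apply/measurable_EFinP; apply: measurable_funTS; exact: smooth_measurable.
Qed.

Lemma massE : (\int[mu]_(t in `[0%R, e]) (g t)%:E = mass%:E)%E.
Proof.
rewrite /mass fineK// ge0_fin_numE; last first.
  by apply: integral_ge0 => t _; rewrite lee_fin.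
have [M gM] := supported_bounded (ltW e0) (smooth_continuous sg) gs.
apply: (@le_lt_trans _ _ (\int[mu]_(t in `[0%R, e]) (cst M%:E) t)%E).
  apply: ge0_le_integral; first exact: measurable_itv.
  - by move=> t _; rewrite lee_fin.
  - exact: smooth_measurable_EFin.
  - exact: measurable_cst.
  - by move=> t _; rewrite /= lee_fin (le_trans (ler_norm _)).
rewrite integral_cst; last exact: measurable_itv.
by rewrite /= lebesgue_measure_itv/= lte_fin e0 -EFinD -EFinM ltry.
Qed.

Lemma mass_gt0 : 0 < mass.
Proof.
have e2 : 0 < e / 2 by rewrite divr_gt0.
have ge2 : 0 < g (e / 2) / 2.
  by rewrite divr_gt0// g_gt0// e2/= ltr_pdivrMr// mulr2n mulrDr mulr1 ltrDl.
have /cvgrPdist_lt/(_ _ ge2)[d /= d0 hd] : g x @[x --> e / 2] --> g (e / 2).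
  exact: smooth_continuous.
pose r := Num.min (d / 2) (e / 2).
have r0 : 0 < r by rewrite lt_min !divr_gt0.
have rd : r < d.
  by rewrite (@le_lt_trans _ _ (d / 2))// ?ge_min ?lexx// ltr_pdivrMr// mulr2n mulrDr mulr1 ltrDl.
have re : r <= e / 2 by rewrite ge_min lexx orbT.
have sub : `[e / 2, e / 2 + r]%classic `<=` `[0, e]%classic.
  move=> t /=; rewrite !in_itv/= => /andP[h1 h2]; apply/andP; split; first lra.
  lra.
rewrite -lte_fin -massE.
apply: (@lt_le_trans _ _ (\int[mu]_(t in `[(e / 2)%R, (e / 2 + r)%R]) (cst (g (e / 2) / 2)%:E) t)%E).
  rewrite integral_cst; last exact: measurable_itv.
  rewrite /= lebesgue_measure_itv/= lte_fin ltrDl r0 -EFinD -EFinM lte_fin mulr_gt0//.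
  by rewrite addrAC subrr add0r.
apply: (@le_trans _ _ (\int[mu]_(t in `[(e / 2)%R, (e / 2 + r)%R]) (g t)%:E)%E).
  apply: ge0_le_integral; first exact: measurable_itv.
  - by move=> t _; rewrite lee_fin ltW.
  - exact: measurable_cst.
  - exact: smooth_measurable_EFin.
  - move=> t /=; rewrite in_itv/= => /andP[h1 h2]; rewrite lee_fin.
    have : `|g (e / 2) - g t| < g (e / 2) / 2.
      by apply: hd => /=; rewrite ler0_norm ?subr_le0// opprB; lra.
    by rewrite ltr_norml => /andP[_]; lra.
apply: ge0_subset_integral => //; try exact: measurable_itv.
- exact: smooth_measurable_EFin.
- by move=> t _; rewrite lee_fin.
Qed.

(** The mass does not depend on s.  This is what allows averages at two different
points to be compared after division by the mass. *)
Lemma integral_translate s (I : set R) : measurable I -> `[s, s + e]%classic `<=` I ->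
  (\int[mu]_(t in I) (translate g s t)%:E = mass%:E)%E.
Proof.
move=> mI JI.
have sgs := smooth_translate (s := s) sg.
rewrite -massE -(setDUK JI) ge0_integral_setU; last 5 first.
- exact: measurable_itv.
- by apply: measurableD; [exact: mI|exact: measurable_itv].
- exact: smooth_measurable_EFin.
- by move=> t _; rewrite lee_fin; exact: g_ge0.
- by rewrite disj_set2E setDIK.
rewrite [X in (_ + X)%E](_ : _ = 0%E) ?adde0; last first.
  rewrite (eq_integral (cst 0%E)) ?integral0// => t; rewrite inE => -[_ /= nJ].
  rewrite (supported_translate (s := s) gs)//; apply/negP => /andP[h1 h2].
  by apply: nJ; rewrite in_itv/= -[s]add0r h1/= add0r addrC.
have dF (x : R) : is_derive x (1 : R) (fun x => 1 * x + s) 1.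
  apply: (@is_derive_quadratic _ _ _ _ 0 1) => // h _.
  by rewrite mul0r normr_le0; apply/eqP; ring.
have cF (x0 : R) : 1 * x + s @[x --> x0] --> 1 * x0 + s.
  apply: cvgD; last exact: cvg_cst.
  by apply: cvgM; [exact: cvg_cst|exact: cvg_id].
have F1 : derive1 (fun x : R => 1 * x + s) = cst 1 by exact: derive1_is_derive.
have := @integration_by_substitution_increasing R (fun x => 1 * x + s) (translate g s) 0 e.
rewrite F1 !mul1r add0r (addrC e) => ->.
- apply: eq_integral => t _; congr (_%:E).
  suff <- : translate g s (1 * t + s) * 1 = g t by [].
  by rewrite mulr1 mul1r /translate addrK.
- exact: ltW.
- by move=> x y _ _ xy; rewrite !mul1r ltrD2r.
- by move=> x _; exact: cvg_cst.
- exact: is_cvg_cst.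
- exact: is_cvg_cst.
- split.
  + by move=> x _; exact: (@ex_derive _ _ _ _ _ _ _ (dF x)).
  + by apply: cvg_at_right_filter; exact: cF.
  + by apply: cvg_at_left_filter; exact: cF.
- by apply: continuous_subspaceT; exact: smooth_continuous.
Qed.

End Mass.

(** * The eigenvalue equation tested against scalar functions *)

Section WeightedIntegrals.
Context {R : realType} {H : completeNormedModType R[i]}.
Local Notation mu := (@lebesgue_measure R).
Variables (I : set R) (mI : measurable I) (u : R -> H) (hu : L2 I u).

Definition weighted_integral (f : R -> R) : H :=
  bochner_integral I (fun t => (f t)%:C *: u t).

Definition weighted_integrable (f : R -> R) : Prop :=
  is_bochner_integral I (fun t => (f t)%:C *: u t) (weighted_integral f).

(** From |u| <= 1 + |u|^2 on a set of finite measure. *)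
Lemma L1norm_indic_lt (J : set R) : measurable J -> (mu J < +oo)%E ->
  (L1norm I (fun t => (\1_J t)%:C *: u t)%R < +oo)%E.
Proof.
move=> mJ fJ; have [mu_ u2] := hu.
have mJu : strongly_measurable I (fun t => (\1_J t : R)%:C *: u t).
  exact: strongly_measurableZ.
have mu2 : measurable_fun I (fun t => (rnorm (u t) ^+ 2)%:E).
  apply/measurable_EFinP; apply: measurable_funX; apply/measurable_EFinP.
  exact: measurable_rnorm.
have m1 : measurable_fun I (fun t => (\1_J t : R)%:E).
  apply/measurable_EFinP.
  exact: measurable_indic.
apply: (@le_lt_trans _ _ (\int[mu]_(t in I) (\1_J t)%:E +
    \int[mu]_(t in I) (rnorm (u t) ^+ 2)%:E)%E).
  rewrite -ge0_integralD; last 5 first.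
  - exact: mI.
  - by move=> t _; rewrite lee_fin indicE.
  - exact: m1.
  - by move=> t _; rewrite lee_fin sqr_ge0.
  - exact: mu2.
  apply: ge0_le_integral; first exact: mI.
  - by move=> t _; rewrite lee_fin rnorm_ge0.
  - exact: measurable_rnorm.
  - exact: emeasurable_funD.
  - move=> t _; rewrite -EFinD lee_fin rnormZr indicE.
    case: (t \in J) => /=; last by rewrite normr0 mul0r add0r sqr_ge0.
    rewrite normr1 mul1r; have := sqr_ge0 (rnorm (u t) - 1); have := rnorm_ge0 (u t).
    by rewrite !expr2; nra.
rewrite integral_indic//; apply: lte_add_pinfty => //.
apply: le_lt_trans fJ; apply: le_measure; rewrite ?inE//.
by apply: measurableI.
Qed.

(** The constant K is the integral of |u| over J, so that U(f) is controlled by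
the supremum of f alone. *)
Lemma weighted_integrable_bounded (J : set R) : measurable J -> (mu J < +oo)%E ->
  exists2 K : R, 0 <= K & forall (f : R -> R) (M : R), 0 <= M -> measurable_fun setT f ->
    (forall t, `|f t| <= M * \1_J t) ->
    weighted_integrable f /\ rnorm (weighted_integral f) <= M * K.
Proof.
move=> mJ fJ; have [mu_ u2] := hu.
have fK := L1norm_indic_lt mJ fJ.
have mw (f : R -> R) : measurable_fun setT f -> strongly_measurable I (fun t => (f t)%:C *: u t).
  by move=> mf; apply: strongly_measurableZ => //; exact: measurable_funTS.
exists (fine (L1norm I (fun t => (\1_J t : R)%:C *: u t))).
  by apply: fine_ge0; exact: L1norm_ge0.
move=> f M M0 mf fM.
have mJu := mw _ (measurable_indic mJ).
have le1 : (L1norm I (fun t => (f t)%:C *: u t)%R <=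
    M%:E * L1norm I (fun t => (\1_J t : R)%:C *: u t)%R)%E.
  rewrite /L1norm -ge0_integralZl; last 4 first.
  - exact: mI.
  - exact: measurable_rnorm.
  - by move=> t _; rewrite lee_fin rnorm_ge0.
  - by rewrite lee_fin.
  apply: ge0_le_integral; first exact: mI.
  - by move=> t _; rewrite lee_fin rnorm_ge0.
  - by apply: measurable_rnorm => //; exact: mw.
  - by apply: measurable_funeM; exact: measurable_rnorm.
  - move=> t _; rewrite -EFinM lee_fin !rnormZr mulrA ler_wpM2r ?rnorm_ge0//.
    by rewrite (ger0_norm (_ : 0 <= \1_J t))// indicE.
have ff : (L1norm I (fun t => (f t)%:C *: u t)%R < +oo)%E.
  apply: (le_lt_trans le1); rewrite -(@fineK _ (L1norm I _)) ?ge0_fin_numE ?L1norm_ge0//.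
  by rewrite -EFinM ltry.
have [y iy] := bochner_exists mI (mw _ mf) ff.
have wi : weighted_integrable f.
  by rewrite /weighted_integrable /weighted_integral (bochner_integralE mI iy).
split=> //; rewrite -lee_fin EFinM.
apply: (le_trans (rnorm_bochner_le mI wi)); apply: (le_trans le1).
by rewrite fineK// ge0_fin_numE// L1norm_ge0.
Qed.

Lemma weighted_integral_linear (a : R) f g : weighted_integrable f -> weighted_integrable g ->
  weighted_integral (fun t => a * f t + g t) =
  a%:C *: weighted_integral f + weighted_integral g.
Proof.
move=> wf wg; apply: bochner_integralE => //.
have waf : is_bochner_integral I (fun t => a%:C *: ((f t)%:C *: u t))
    (a%:C *: weighted_integral f).
  apply: (@bochner_map _ _ mI _ _ (fun x : H => a%:C *: x) `|a|) wf.
    by move=> c x y; rewrite scalerDr !scalerA mulrC.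
  by move=> x; rewrite rnormZr.
rewrite (_ : (fun t => _) = (fun t => a%:C *: ((f t)%:C *: u t) + (g t)%:C *: u t)).
  exact: bochnerD.
by apply/funext => t; rewrite rmorphD rmorphM/= scalerDl scalerA.
Qed.

End WeightedIntegrals.

Section EigenvalueEquation.
Context {R : realType} {H : completeNormedModType R[i]}.
Variable dot : {dot H for (@Num.conj R[i])}.
Hypothesis hH : is_hilbert dot.
Variable A : linear_operator H.
Hypothesis hA : selfadjoint dot A.
Variable Hm : negative_space dot A.
Variables (I : set R) (mI : measurable I) (u : R -> H) (lam : R[i]).
Hypothesis hu : maximal_operator Hm I u (lam *: u).
Local Notation U := (weighted_integral I u).

Lemma real_test_function (f : R -> R) : smooth f ->
  (exists K : set R, [/\ compact K, K `<=` I & forall t, ~ K t -> f t = 0]) ->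
  test_function I (fun t => (f t)%:C).
Proof.
move=> sf [K [cK KI f0]]; split=> //; last first.
  by exists K; split=> // t Kt; rewrite f0.
move=> n; elim: n {sf f0} => [|n IHn] t; first exact: derivable_cst.
rewrite derive1Sn (_ : derive1 _ = cst 0); first by exact: IHn.
by apply/funext => x; rewrite derive1E; exact: derive_cst.
Qed.

Lemma cderive_real (f : R -> R) : cderive (fun t => (f t)%:C) = (fun t => (derive1 f t)%:C).
Proof.
apply/funext => t; rewrite /cderive/=.
rewrite (_ : derive1 (fun=> 0) t = 0)// derive1E; exact: derive_cst.
Qed.

(** The three terms of the equation in the negative space are images of U(f) and
U(f') under bounded linear maps.  Only then does pairing with the domain of A
bring the equation back to H. *)
Lemma weak_eigenvalue_equation (f : R -> R) : test_function I (fun t => (f t)%:C) ->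
  weighted_integrable I u f -> weighted_integrable I u (derive1 f) ->
  dom A (U f) /\ A (U f) = lam *: U f + 'i%C *: U (derive1 f).
Proof.
move=> tf wf wf'; apply: (tilde_eq_emb hH hA (Hm := Hm)).
have [_ _ /(_ _ tf)] := hu.
have emb_lin a x z : neg_emb Hm (a *: x + z) = a *: neg_emb Hm x + neg_emb Hm z.
  by rewrite linearP.
have tl := tilde_linear hH hA Hm.
have tZ a x : tilde Hm (a *: x) = a *: tilde Hm x.
  have t0 : tilde Hm 0 = 0.
    by apply/eqP; rewrite -rnorm_eq0 eq_le rnorm_ge0 andbT (le_trans (rnorm_tilde_le hH hA _ _))// rnorm0.
  by rewrite -[a *: x]addr0 tl t0 addr0.
have embP g : weighted_integrable I u g ->
    distr_of I (neg_emb Hm \o u) (fun t => (g t)%:C) = neg_emb Hm (U g).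
  move=> wg; apply: bochner_integralE => //.
  have := bochner_map mI emb_lin (C := 1) _ wg.
  rewrite (_ : neg_emb Hm \o (fun t => (g t)%:C *: u t) = (fun t => (g t)%:C *: (neg_emb Hm \o u) t)).
    by move=> hb; apply: hb => x; rewrite mul1r; exact: rnorm_neg_emb_le.
  by apply/funext => t /=; rewrite linearZ.
have tildeP g : weighted_integrable I u g ->
    distr_of I (tilde Hm \o u) (fun t => (g t)%:C) = tilde Hm (U g).
  move=> wg; apply: bochner_integralE => //.
  have := bochner_map mI tl (C := 1) _ wg.
  rewrite (_ : tilde Hm \o (fun t => (g t)%:C *: u t) = (fun t => (g t)%:C *: (tilde Hm \o u) t)).
    by move=> hb; apply: hb => x; rewrite mul1r; exact: rnorm_tilde_le.
  by apply/funext => t /=; rewrite tZ.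
have lamP : distr_of I (neg_emb Hm \o (lam *: u)) (fun t => (f t)%:C) =
    neg_emb Hm (lam *: U f).
  apply: bochner_integralE => //.
  have := bochner_map mI (f := fun x => neg_emb Hm (lam *: x))
    (C := rnorm (lam : R[i]^o)) _ _ wf.
  rewrite (_ : _ \o (fun t => (f t)%:C *: u t) = (fun t => (f t)%:C *: (neg_emb Hm \o (lam *: u)) t)).
    move=> hb; apply: hb => [a x z|x].
      by rewrite scalerDr !scalerA mulrC -scalerA emb_lin.
    by rewrite -rnormZ; exact: rnorm_neg_emb_le.
  by apply/funext => t /=; rewrite !linearZ/= !scalerA mulrC.
rewrite /distr_deriv cderive_real embP// tildeP// lamP => /eqP.
rewrite scalerN addrC subr_eq => /eqP ->.
by rewrite -[in LHS]linearZ/= -linearD.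
Qed.

(** By symmetry <A (U f), U f> is real; the identity is the imaginary part of
<A (U f), U f> = <lambda U(f) + i U(f'), U(f)>. *)
Lemma weak_energy_identity (f : R -> R) : test_function I (fun t => (f t)%:C) ->
  weighted_integrable I u f -> weighted_integrable I u (derive1 f) ->
  complex.Re (dot (U (derive1 f)) (U f)) = - (complex.Im lam * rnorm (U f) ^+ 2).
Proof.
move=> tf wf wf'; have [dU AU] := weak_eigenvalue_equation tf wf wf'.
have sym := selfadjoint_symmetric hA dU dU.
have im0 : complex.Im (dot (A (U f)) (U f)) = 0.
  have : dot (A (U f)) (U f) = Num.conj (dot (A (U f)) (U f)).
    by rewrite {1}sym; exact: dotC.
  by case: (dot _ _) => a b [] /eqP; rewrite -addr_eq0 -mulr2n mulrn_eq0/= => /eqP.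
move: im0; rewrite AU linearDl/= !linearZl_LR/= (dot_self hH).
case: (dot (U (derive1 f)) (U f)) => a b.
case: lam => x y /=.
by rewrite mulr0 !mul0r !add0r mul1r => h; apply/eqP; rewrite -addr_eq0 addrC h.
Qed.

End EigenvalueEquation.

(** * Growth of the averages *)

Section GrowthLaw.
Context {R : realType} {H : completeNormedModType R[i]}.
Local Notation mu := (@lebesgue_measure R).
Variable dot : {dot H for (@Num.conj R[i])}.
Hypothesis hH : is_hilbert dot.
Variable A : linear_operator H.
Hypothesis hA : selfadjoint dot A.
Variable Hm : negative_space dot A.
Variables (I : set R) (mI : measurable I) (u : R -> H) (lam : R[i]).
Hypothesis hu : maximal_operator Hm I u (lam *: u).
Variables (g : R -> R) (e : R).
Hypotheses (e0 : 0 < e) (sg : smooth g) (gs : supported 0 e g).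
Variables (b c : R).
Hypothesis bcI : `[b, c]%classic `<=` I.
Local Notation U s := (weighted_integral I u (translate g s)).

Lemma rnorm_add_sqr (a v : H) :
  rnorm (a + v) ^+ 2 = rnorm a ^+ 2 + 2 * complex.Re (dot v a) + rnorm v ^+ 2.
Proof.
rewrite !(rnorm_sqr hH) linearDl !linearDr/= (dotC dot a v).
case: (dot v a) => x y; case: (dot a a) => x1 y1; case: (dot v v) => x2 y2 /=.
by ring.
Qed.

(** Taylor's formula for g, integrated against u: U is differentiable in the
translation parameter, with derivative - U(g').  The bound is uniform as long as
the supports stay in [b, c]. *)
Lemma translated_integral_expansion : exists2 C : R, 0 <= C & forall s h,
  b <= s -> s + e <= c -> b <= s + h -> s + h + e <= c ->
  weighted_integrable I u (translate g s) /\
  weighted_integrable I u (translate (derive1 g) s) /\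
  rnorm (U (s + h) - U s + h%:C *: weighted_integral I u (translate (derive1 g) s)) <=
    C * h ^+ 2.
Proof.
have sg1 := smooth_derive1 sg; have sg2 := smooth_derive1 sg1.
have gs1 := supported_derive1 gs; have gs2 := supported_derive1 gs1.
have [M0 hM0] := supported_bounded (ltW e0) (smooth_continuous sg) gs.
have [M1 hM1] := supported_bounded (ltW e0) (smooth_continuous sg1) gs1.
have [M2 hM2] := supported_bounded (ltW e0) (smooth_continuous sg2) gs2.
have M20 : 0 <= M2 by exact: le_trans (hM2 0).
have mJ : measurable (`[b, c]%classic : set R) by exact: measurable_itv.
have fJ : (mu `[b, c]%classic < +oo)%E.
  rewrite lebesgue_measure_itv/=; case: ifPn => // _.
  by rewrite -EFinD ltry.
have [hL _ _] := hu.
have [K K0 hK] := weighted_integrable_bounded mI hL mJ fJ.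
have wt (f : R -> R) M s : smooth f -> supported 0 e f -> (forall t, `|f t| <= M) ->
    b <= s -> s + e <= c -> [/\ measurable_fun setT (translate f s),
      forall t, `|translate f s t| <= M * \1_(`[b, c]%classic) t &
      weighted_integrable I u (translate f s)].
  move=> sf fs fM bs sec.
  have mf : measurable_fun setT (translate f s).
    by apply: smooth_measurable; exact: smooth_translate.
  have bf : forall t, `|translate f s t| <= M * \1_(`[b, c]%classic) t.
    have c1 : b <= 0 + s by rewrite add0r.
    have c2 : e + s <= c by rewrite addrC.
    have fM' t : `|translate f s t| <= M by exact: fM.
    exact: (supported_le_indic (supported_translate (s := s) fs) c1 c2 fM').
  split=> //; have M_ : 0 <= M by exact: le_trans (fM 0).
  by case: (hK _ _ M_ mf bf).
exists (M2 * K); first exact: mulr_ge0.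
move=> s h bs sec bsh shec.
have [m0 b0 w0] := wt _ _ _ sg gs hM0 bs sec.
have [m1 b1 w1] := wt _ _ _ sg1 gs1 hM1 bs sec.
have [mh bh wh] := wt _ _ _ sg gs hM0 bsh shec.
split=> //; split=> //.
(* The remainder r is written with the shape a * f + f' of the linearity lemma. *)
pose k := fun t => -1 * translate g s t + translate g (s + h) t.
have mk : measurable_fun setT k.
  apply: measurable_funD => //; apply: measurable_funM => //.
have M00 : 0 <= M0 by exact: le_trans (hM0 0).
have wk : weighted_integrable I u k.
  have bk t : `|k t| <= (M0 + M0) * \1_(`[b, c]%classic) t.
    rewrite /k; apply: (le_trans (ler_normD _ _)); rewrite mulN1r normrN mulrDl.
    exact: lerD.
  by case: (hK k _ (addr_ge0 M00 M00) mk bk).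
pose r := fun t => h * translate (derive1 g) s t + k t.
have mr : measurable_fun setT r.
  apply: measurable_funD => //; apply: measurable_funM => //.
have br t : `|r t| <= M2 * h ^+ 2 * \1_(`[b, c]%classic) t.
  have [tJ|tJ] := boolP (t \in `[b, c]%classic).
    rewrite indicE tJ mulr1 -sqrrN.
    have := smooth_taylor1 (t - s) (- h) sg hM2.
    congr (_ <= _); congr (`|_|); rewrite /r /k /translate.
    by rewrite (_ : t - (s + h) = t - s - h) ?opprD ?addrA//; ring.
  move: (b0 t) (b1 t) (bh t); rewrite indicE (negbTE tJ) !mulr0 !normr_le0.
  by move=> /eqP t0 /eqP t1 /eqP th; rewrite /r /k t0 t1 th !mulr0 !addr0.
have [_ rr] := hK r (M2 * h ^+ 2) (mulr_ge0 M20 (sqr_ge0 h)) mr br.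
have rE : weighted_integral I u r = _ := weighted_integral_linear mI h w1 wk.
have kE : weighted_integral I u k = _ := weighted_integral_linear mI (-1) w0 wh.
rewrite rE kE rmorphN1 scaleN1r mulrAC in rr.
by rewrite addrC (addrC (weighted_integral I u (translate g (s + h)))).
Qed.

(** Expand |U(s + h)|^2 to first order in h; the linear term is
- 2 Re <U(g'), U(g)>, given by the energy identity. *)
Lemma is_derive_energy s : b < s -> s + e < c ->
  is_derive s (1 : R) (fun s => rnorm (U s) ^+ 2) (2 * complex.Im lam * rnorm (U s) ^+ 2).
Proof.
move=> bs sec; have [C C0 hC] := translated_integral_expansion.
pose d := weighted_integral I u (translate (derive1 g) s).
pose a := U s.
have [w0 [w1 _]] : weighted_integrable I u (translate g s) /\
    weighted_integrable I u (translate (derive1 g) s) /\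
    rnorm (U (s + 0) - U s + 0%:C *: d) <= C * 0 ^+ 2.
  by apply: hC; rewrite ?addr0 ltW.
have tf : test_function I (fun t => (translate g s t)%:C).
  apply: real_test_function; first exact: smooth_translate.
  exists `[b, c]%classic; split=> //; first exact: segment_compact.
  move=> t /negP; rewrite /= in_itv/= => tbc; apply: (supported_translate (s := s) gs).
  apply: contra tbc => /andP[]; rewrite add0r (addrC e) => st te.
  by rewrite (le_trans (ltW bs) st) (le_trans te (ltW sec)).
have w1' : weighted_integrable I u (derive1 (translate g s)).
  by rewrite derive1_translate.
have en : complex.Re (dot d a) = - (complex.Im lam * rnorm a ^+ 2).
  have := weak_energy_identity hH hA mI hu tf w0 w1'.
  by rewrite derive1_translate.
(* Small enough to keep the supports in [b, c], and to have h^2 <= |h|. *)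
pose delta := Num.min 1 (Num.min (s - b) (c - e - s)).
apply: (@is_derive_quadratic _ _ _ _ (2 * C * rnorm a + (rnorm d + C) ^+ 2) delta).
  rewrite !lt_min ltr01 subr_gt0 bs/= subr_gt0; lra.
move=> h; rewrite !lt_min => /andP[h1 /andP[]]; rewrite !ltr_norml.
move=> /andP[hb _] /andP[_ hc].
have [_ [_ rC]] : weighted_integrable I u (translate g s) /\
    weighted_integrable I u (translate (derive1 g) s) /\
    rnorm (U (s + h) - U s + h%:C *: d) <= C * h ^+ 2.
  by apply: hC; lra.
pose r := U (s + h) - U s + h%:C *: d.
pose v := r - h%:C *: d.
have UE : U (s + h) = a + v by rewrite /v /r addrK [RHS]addrC subrK.
have vr : complex.Re (dot v a) = complex.Re (dot r a) + h * complex.Im lam * rnorm a ^+ 2.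
  rewrite /v linearBl linearZl_LR/= -mulrA -[complex.Im lam * _]opprK -en.
  case: (dot r a) => x y; case: (dot d a) => x' y' /=.
  by rewrite mul0r subr0 mulrN.
have vb : rnorm v ^+ 2 <= h ^+ 2 * (rnorm d + C) ^+ 2.
  have v0 : rnorm v <= `|h| * (rnorm d + C).
    rewrite /v; apply: (le_trans (ler_rnormB _ _)).
    rewrite rnormZr mulrDr addrC lerD2l; apply: (le_trans rC).
    rewrite -(real_normK (num_real h)) expr2 mulrA mulrC mulrA ler_piMr//.
      by rewrite mulr_ge0.
    exact: ltW.
  rewrite -(real_normK (num_real h)) -exprMn ler_sqr ?nnegrE ?rnorm_ge0//.
  by rewrite mulr_ge0// addr_ge0// rnorm_ge0.
rewrite UE rnorm_add_sqr -/a vr.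
rewrite (_ : _ - _ - _ = 2 * complex.Re (dot r a) + rnorm v ^+ 2); last by ring.
apply: (le_trans (ler_normD _ _)).
rewrite [leRHS]mulrDl; apply: lerD; last by rewrite ger0_norm ?sqr_ge0// mulrC.
rewrite normrM ger0_norm// -!mulrA ler_wpM2l//.
apply: (le_trans (Re_le_rnorm _)); apply: (le_trans (dot_cauchy_schwarz hH _ _)).
by rewrite (mulrC (rnorm a)) mulrA ler_wpM2r ?rnorm_ge0.
Qed.

(** The function |U(s)|^2 exp(- 2 k s) has zero derivative. *)
Lemma translated_integral_growth x y : b < x -> x <= y -> y + e < c ->
  rnorm (U y) = expR (complex.Im lam * (y - x)) * rnorm (U x).
Proof.
move=> bx xy yec; set k := complex.Im lam.
pose N := fun s => rnorm (U s) ^+ 2.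
(* The term + 0 gives the exponent the affine shape of is_derive_affine. *)
pose F : R -> R := N * (fun s => expR (- (2 * k) * s + 0)).
have dF z : z \in `[x, y] -> is_derive z (1 : R) F 0.
  rewrite in_itv/= => /andP[xz zy].
  have dN := is_derive_energy (lt_le_trans bx xz) (le_lt_trans (lerD zy (lexx e)) yec).
  have dE := is_derive_affine (is_derive_expR (- (2 * k) * z + 0)).
  apply: (is_derive_eq (is_deriveM dN dE)).
  by rewrite /GRing.scale/= -/k /N; ring.
have dFo z : z \in `]x, y[ -> is_derive z (1 : R) F (cst 0 z).
  by move=> zxy; apply: dF; exact: subset_itv_oo_cc.
have cF : {within `[x, y], continuous F}.
  apply: derivable_within_continuous => z zxy.
  exact: (@ex_derive _ _ _ _ _ _ _ (dF z zxy)).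
have [z _] := MVT_segment xy dFo cF.
rewrite mul0r => /eqP; rewrite subr_eq0 => /eqP FE.
have {}FE : N y * expR (- (2 * k) * y + 0) = N x * expR (- (2 * k) * x + 0) by [].
have NE : N y = expR (2 * k * (y - x)) * N x.
  apply: (@mulIf _ (expR (- (2 * k) * y + 0))); first by rewrite gt_eqF// expR_gt0.
  rewrite FE [RHS]mulrAC -expRD mulrC; congr (expR _ * _); ring.
apply/eqP; rewrite -(@eqrXn2 _ 2)// ?mulr_ge0 ?expR_ge0 ?rnorm_ge0//.
rewrite exprMn -expRM_natl -/(N y) NE; apply/eqP; congr (expR _ * _).
by rewrite mulrA.
Qed.

End GrowthLaw.

(** * Averages over small supports *)

Section Mollifier.
Context {R : realType} {H : completeNormedModType R[i]}.
Local Notation mu := (@lebesgue_measure R).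
Variables (I : set R) (mI : measurable I).

Variables (u : R -> H) (hu : L2 I u).
Variables (g : R -> R) (e : R).
Hypotheses (e0 : 0 < e) (sg : smooth g) (gs : supported 0 e g).
Hypotheses (g_ge0 : forall t, 0 <= g t) (g_gt0 : forall t, 0 < t < e -> 0 < g t).
Variables (s : R) (sI : `[s, s + e]%classic `<=` I).
Variables (x : H) (d : R) (d0 : 0 <= d).
Hypothesis ux : {ae mu, forall t, I t -> s <= t <= s + e -> rnorm (u t - x) <= d}.
Local Notation f := (translate g s).
Local Notation J := (`[s, s + e]%classic : set R).

Lemma translate_ge0 t : 0 <= f t.
Proof. exact: g_ge0. Qed.

Lemma translate_bound : exists2 M : R, 0 <= M & forall t, f t <= M * \1_J t.
Proof.
have [M gM] := supported_bounded (ltW e0) (smooth_continuous sg) gs.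
exists M; first exact: le_trans (gM 0).
move=> t; apply: (le_trans (ler_norm _)).
have c1 : s <= 0 + s by rewrite add0r.
have c2 : e + s <= s + e by rewrite addrC.
have fM t' : `|f t'| <= M by exact: gM.
exact: (supported_le_indic (supported_translate (s := s) gs) c1 c2 fM).
Qed.

Lemma measure_support : mu J = e%:E.
Proof.
by rewrite lebesgue_measure_itv/= lte_fin ltrDl e0 -EFinD addrAC subrr add0r.
Qed.

Lemma mollifier_integrable : weighted_integrable I u f.
Proof.
have [M M0 fM] := translate_bound.
have fJ : (mu J < +oo)%E by rewrite measure_support ltry.
have [K K0 hK] := weighted_integrable_bounded mI hu (measurable_itv _) fJ.
have bf t : `|f t| <= M * \1_J t by rewrite ger0_norm ?translate_ge0.
by case: (hK f M M0 (smooth_measurable (smooth_translate (s := s) sg)) bf).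
Qed.

Lemma mollifier_le : rnorm (weighted_integral I u f) <= mass g e * (rnorm x + d).
Proof.
have mf : measurable_fun I (fun t => (f t)%:E).
  by apply: smooth_measurable_EFin; exact: smooth_translate.
have xd : 0 <= rnorm x + d by rewrite addr_ge0// rnorm_ge0.
rewrite -lee_fin; apply: (@le_trans _ _ (\int[mu]_(t in I) ((rnorm x + d) * f t)%R%:E)%E).
  apply: (rnorm_bochner_ae_le mI mollifier_integrable).
  - apply/measurable_EFinP; apply: measurable_funM; first exact: measurable_cst.
    exact/measurable_EFinP.
  - by move=> t; rewrite mulr_ge0// translate_ge0.
  - apply: ae_lebesgueS ux => t ut It; rewrite rnormZr (ger0_norm (translate_ge0 t)) mulrC.
    have [tJ|tJ] := boolP (s <= t <= s + e).
      rewrite ler_wpM2r ?translate_ge0// -[u t](subrK x) addrC.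
      by apply: (le_trans (ler_rnormD _ _)); rewrite lerD2l ut.
    rewrite (supported_translate (s := s) gs) ?mulr0//.
    by rewrite add0r (addrC e).
under eq_integral do rewrite EFinM.
rewrite (_ : integral _ _ _ = ((rnorm x + d)%:E * \int[mu]_(t in I) (f t)%:E)%E); last first.
  apply: ge0_integralZl; [exact: mI|exact: mf| |by rewrite lee_fin].
  by move=> t _; rewrite lee_fin translate_ge0.
by rewrite (integral_translate e0 sg gs g_ge0 mI sI) -EFinM lee_fin mulrC.
Qed.

(** A lower bound cannot be read off the norm inequality for Bochner integrals.
It is applied instead to the complementary weight q = M 1_J - f >= 0: the
integral of M 1_J x is known exactly, and it differs from U(f) by at most
|x| int q + d int f. *)
Lemma mollifier_ge : mass g e * (rnorm x - d) <= rnorm (weighted_integral I u f).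
Proof.
have [M M0 fM] := translate_bound.
have mf : measurable_fun I (fun t => (f t)%:E).
  by apply: smooth_measurable_EFin; exact: smooth_translate.
pose q t : R := M * \1_J t - f t.
have q0 t : 0 <= q t by rewrite subr_ge0.
have mJ1 : measurable_fun I (\1_J : R -> R) by apply: measurable_indic; exact: measurable_itv.
have mq : measurable_fun I (fun t => (q t)%:E).
  apply/measurable_EFinP; apply: measurable_funB; last exact/measurable_EFinP.
  by apply: measurable_funM => //; exact: measurable_cst.
have intf := integral_translate e0 sg gs g_ge0 mI sI.
have intq : (\int[mu]_(t in I) (q t)%:E + (mass g e)%:E = (M * e)%:E)%E.
  rewrite -intf -ge0_integralD; last 5 first.
  - exact: mI.
  - by move=> t _; rewrite lee_fin.
  - exact: mq.
  - by move=> t _; rewrite lee_fin translate_ge0.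
  - exact: mf.
  under eq_integral do rewrite -EFinD subrK EFinM.
  rewrite (_ : integral _ _ _ = (M%:E * \int[mu]_(t in I) (\1_J t)%:E)%E); last first.
    apply: ge0_integralZl; [exact: mI|exact/measurable_EFinP| |by rewrite lee_fin].
    by move=> t _; rewrite lee_fin indicE.
  rewrite integral_indic; [|exact: mI|exact: measurable_itv].
  by rewrite (setIidl sI) EFinM; congr (_ * _)%E; exact: measure_support.
have fq : (\int[mu]_(t in I) (q t)%:E = (M * e - mass g e)%:E)%E.
  by rewrite EFinB -intq addeK.
(* iD is the Bochner integral of the function M 1_J x - f u. *)
have iJ := @bochner_indic R I mI H J (M%:C *: x) (measurable_itv _) sI.
have {}iJ := iJ (ltac:(by rewrite measure_support ltry)).
have iN := @bochner_map _ _ mI _ _ (fun z : H => -1 *: z) 1 _ _ _ _ mollifier_integrable.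
have {}iN := iN (ltac:(by move=> a z w; rewrite scalerDr !scalerA mulrC)).
have {}iN := iN (ltac:(by move=> z; rewrite scaleN1r rnormN mul1r)).
have iD := bochnerD mI iJ iN.
have key : rnorm ((fine (mu J))%:C *: (M%:C *: x) + -1 *: weighted_integral I u f) <=
    rnorm x * (M * e - mass g e) + d * mass g e.
  rewrite -lee_fin; apply: (@le_trans _ _ (\int[mu]_(t in I) (rnorm x * q t + d * f t)%R%:E)%E).
    apply: (rnorm_bochner_ae_le mI iD).
    - apply/measurable_EFinP; apply: measurable_funD; apply: measurable_funM;
        try exact: measurable_cst; exact/measurable_EFinP.
    - by move=> t; rewrite addr_ge0// mulr_ge0// ?rnorm_ge0// translate_ge0.
    - apply: ae_lebesgueS ux => t ut It /=.
      have [tJ|tJ] := boolP (s <= t <= s + e).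
        rewrite mem_set/= ?in_itv// /q indicE mem_set/= ?in_itv//= mulr1.
        rewrite (_ : _ + _ = (M - f t)%:C *: x + (f t)%:C *: (x - u t)); last first.
          by rewrite scalerBr rmorphB scalerBl addrA subrK scaleN1r.
        apply: (le_trans (ler_rnormD _ _)); rewrite !rnormZr !ger0_norm ?translate_ge0//; last first.
          by have := fM t; rewrite indicE mem_set/= ?in_itv// mulr1 subr_ge0.
        rewrite mulrC lerD2l mulrC ler_wpM2r ?translate_ge0// rdistC.
        exact: ut.
      have f0 : f t = 0.
        by apply: (supported_translate (s := s) gs); rewrite add0r (addrC e).
      rewrite f0 scale0r scaler0 addr0 mulr0 addr0 memNset/=; last by rewrite in_itv/=; exact/negP.
      by rewrite rnorm0 mulr_ge0// rnorm_ge0.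
  under eq_integral do rewrite EFinD !EFinM.
  rewrite (_ : integral _ _ _ = (\int[mu]_(t in I) ((rnorm x)%:E * (q t)%:E) +
      \int[mu]_(t in I) (d%:E * (f t)%:E))%E); last first.
    apply: ge0_integralD; first exact: mI.
    - by move=> t _; rewrite -EFinM lee_fin mulr_ge0// rnorm_ge0.
    - exact: measurable_funeM.
    - by move=> t _; rewrite -EFinM lee_fin mulr_ge0// translate_ge0.
    - exact: measurable_funeM.
  have qE : (\int[mu]_(t in I) ((rnorm x)%:E * (q t)%:E) =
      (rnorm x)%:E * \int[mu]_(t in I) (q t)%:E)%E.
    apply: ge0_integralZl; [exact: mI|exact: mq| |by rewrite lee_fin rnorm_ge0].
    by move=> t _; rewrite lee_fin.
  have fE : (\int[mu]_(t in I) (d%:E * (f t)%:E) =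
      d%:E * \int[mu]_(t in I) (f t)%:E)%E.
    apply: ge0_integralZl; [exact: mI|exact: mf| |by rewrite lee_fin].
    by move=> t _; rewrite lee_fin translate_ge0.
  by rewrite qE fE fq intf -!EFinM -EFinD lee_fin.
have e1 : fine (mu J) = e by rewrite measure_support.
rewrite scaleN1r e1 in key.
have tri := le_trans (ler_norm _) (ler_rdist_dist (e%:C *: (M%:C *: x))
  (weighted_integral I u f)).
have := le_trans tri key; rewrite !rnormZr (ger0_norm M0) (ger0_norm (ltW e0)).
lra.
Qed.

End Mollifier.

(** * Growth and vanishing of eigenfunctions *)

Section EigenfunctionGrowth.
Context {R : realType} {H : completeNormedModType R[i]}.
Local Notation mu := (@lebesgue_measure R).
Variable dot : {dot H for (@Num.conj R[i])}.
Hypothesis hH : is_hilbert dot.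
Variable A : linear_operator H.
Hypothesis hA : selfadjoint dot A.
Variable Hm : negative_space dot A.
Variables (i : interval R) (u : R -> H) (lam : R[i]).
Local Notation I := ([set` i] : set R).
Hypothesis oI : open I.
Hypothesis hu : maximal_operator Hm I u (lam *: u).
Variable v : R -> H.
Hypothesis cv : {within closure I, continuous v}.
Hypothesis uv : ae_eq mu I u v.
Local Notation k := (complex.Im lam).

Let mI : measurable I. Proof. exact: measurable_itv. Qed.

Lemma segment_sub_itv x y : I x -> I y -> `[x, y]%classic `<=` I.
Proof.
move=> Ix Iy t /=; rewrite in_itv/= => txy.
exact: (interval_is_interval Ix Iy).
Qed.

(** On both sides of x there is room for the supports used below, and v is almost
constant on the right of x, where the bumps sit. *)
Lemma continuous_rep_near x d : I x -> 0 < d ->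
  \forall e \near 0^'+, `[x - e, x + e + e]%classic `<=` I /\
    forall t, x <= t <= x + e -> rnorm (v t - v x) <= d.
Proof.
move=> Ix d0.
have vx : v t @[t --> x] --> v x.
  have : {within I, continuous v}.
    apply: continuous_subspaceW cv; exact: subset_closure.
  by rewrite continuous_open_subspace// => /(_ x); apply; rewrite inE.
have /rnorm_cvgP/(_ _ d0)[r1 /= r10 hr1] := vx.
have /= [r2 r20 hr2] := (nbhs_ballP _ _).1 (open_nbhs_nbhs (conj oI Ix)).
near=> e.
have e0 : 0 < e by near: e; exact: nbhs_right_gt.
have er1 : e < r1 by near: e; exact: nbhs_right_lt.
have er2 : e < r2 / 2 by near: e; apply: nbhs_right_lt; exact: divr_gt0.
split=> [t /=|t /andP[xt te]].
  rewrite in_itv/= => /andP[h1 h2]; apply: hr2.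
  by rewrite -ball_normE/= ltr_norml; apply/andP; split; lra.
by rewrite rdistC; apply/ltW/hr1 => /=; rewrite ler0_norm; lra.
Unshelve. all: by end_near. Qed.

(** For each d > 0 take a bump so short that v varies by at most d on its
translates to x and to y, compare the averages there, and divide by the mass. *)
Lemma eigenfunction_growth_le x y : I x -> I y -> x <= y ->
  rnorm (v y) = expR (k * (y - x)) * rnorm (v x).
Proof.
move=> Ix Iy xy; set q := expR _.
have q0 : 0 < q by exact: expR_gt0.
have hL : L2 I u by case: hu.
suff key d : 0 < d -> rnorm (v y) <= q * rnorm (v x) + d * (1 + q) /\
    q * rnorm (v x) <= rnorm (v y) + d * (1 + q).
  apply/eqP; rewrite eq_le; apply/andP; split; apply/ler_addgt0Pr => d d0.
    have [+ _] := key (d / (1 + q)) (divr_gt0 d0 (addr_gt0 ltr01 q0)).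
    by rewrite divfK// gt_eqF// addr_gt0.
  have [_] := key (d / (1 + q)) (divr_gt0 d0 (addr_gt0 ltr01 q0)).
  by rewrite divfK// gt_eqF// addr_gt0.
move=> d0.
have [e [e0 [xI vx] [yI vy]]] : exists e, [/\ 0 < e,
    `[x - e, x + e + e]%classic `<=` I /\
      (forall t, x <= t <= x + e -> rnorm (v t - v x) <= d) &
    `[y - e, y + e + e]%classic `<=` I /\
      (forall t, y <= t <= y + e -> rnorm (v t - v y) <= d)].
  have hx := continuous_rep_near Ix d0; have hy := continuous_rep_near Iy d0.
  have /filter_ex[e [? [? ?]]] : \forall e \near 0^'+, 0 < e /\
    (`[x - e, x + e + e]%classic `<=` I /\
      (forall t, x <= t <= x + e -> rnorm (v t - v x) <= d)) /\
    (`[y - e, y + e + e]%classic `<=` I /\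
      (forall t, y <= t <= y + e -> rnorm (v t - v y) <= d)).
    near=> e; split; first by near: e; exact: nbhs_right_gt.
    by split; near: e.
  by exists e.
have [g [sg g0 gs gp]] := bump_exists e0.
have sub z : `[z - e, z + e + e]%classic `<=` I -> `[z, z + e]%classic `<=` I.
  by move=> zI t /=; rewrite in_itv/= => /andP[h1 h2]; apply: zI; rewrite /= in_itv/=; lra.
have bc : `[x - e, y + e + e]%classic `<=` I.
  by apply: segment_sub_itv; [apply: xI|apply: yI]; rewrite /= in_itv/=; lra.
have gr : rnorm (weighted_integral I u (translate g y)) =
    q * rnorm (weighted_integral I u (translate g x)).
  by apply: (translated_integral_growth hH hA mI hu e0 sg gs bc) => //; lra.
have ux z : (forall t, z <= t <= z + e -> rnorm (v t - v z) <= d) ->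
    {ae mu, forall t, I t -> z <= t <= z + e -> rnorm (u t - v z) <= d}.
  by move=> vz; apply: ae_lebesgueS uv => t ut It tz; rewrite ut//; exact: vz.
have m0 := mass_gt0 e0 sg gs g0 gp.
have xle := mollifier_le mI hL e0 sg gs g0 (sub _ xI) (ltW d0) (ux _ vx).
have xge := mollifier_ge mI hL e0 sg gs g0 (sub _ xI) (ltW d0) (ux _ vx).
have yle := mollifier_le mI hL e0 sg gs g0 (sub _ yI) (ltW d0) (ux _ vy).
have yge := mollifier_ge mI hL e0 sg gs g0 (sub _ yI) (ltW d0) (ux _ vy).
rewrite gr in yle yge.
have xle' := ler_wpM2l (ltW q0) xle; have xge' := ler_wpM2l (ltW q0) xge.
move: (mass g e) m0 (rnorm (v x)) (rnorm (v y)) {xle xge} yle yge xle' xge' => m m0 a b.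
move=> yle yge xle' xge'; split; rewrite -(ler_pM2l m0).
  rewrite (_ : m * (q * a + d * (1 + q)) = q * (m * (a + d)) + m * d); last by ring.
  by rewrite -lerBlDr -mulrBr (le_trans yge).
rewrite (_ : m * (q * a) = q * (m * (a - d)) + q * (m * d)); last by ring.
rewrite (_ : m * (b + d * (1 + q)) = m * (b + d) + q * (m * d)); last by ring.
by rewrite lerD2r (le_trans xge').
Unshelve. all: by end_near. Qed.

Lemma eigenfunction_growth x y : I x -> I y ->
  rnorm (v y) = expR (k * (y - x)) * rnorm (v x).
Proof.
move=> Ix Iy; have [xy|yx] := leP x y; first exact: eigenfunction_growth_le.
rewrite (eigenfunction_growth_le Iy Ix (ltW yx)) mulrA -expRD.
by rewrite (_ : _ + _ = 0) ?expR0 ?mul1r//; ring.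
Qed.

(** Both sides are continuous in the point, so the law extends to the finite end
point of the half-line. *)
Lemma eigenfunction_growth_closure x a : I x -> closure I a ->
  rnorm (v a) = expR (k * (a - x)) * rnorm (v x).
Proof.
move=> Ix Ia.
have PF : ProperFilter (within I (nbhs a)) by exact: within_nbhs_proper.
have va : v t @[t --> within I (nbhs a)] --> v a.
  have /subspace_continuousP/(_ _ Ia) := cv.
  apply: cvg_trans; apply: cvg_app => P nP.
  have {}nP : \forall t \near a, closure I t -> P t := nP.
  suff : \forall t \near a, I t -> P t by [].
  by apply: filterS nP => t Pt It; apply: Pt; exact: subset_closure.
have /cvg_rnorm va' := va.
apply: (cvg_unique _ va') => //.
have : (expR (k * (t - x)) * rnorm (v x)) @[t --> within I (nbhs a)] -->
    expR (k * (a - x)) * rnorm (v x).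
  apply: cvg_within_filter; apply: cvgM; last exact: cvg_cst.
  apply: (@cvg_comp _ _ _ (fun t => k * (t - x)) expR); last exact: continuous_expR.
  by apply: cvgM; [exact: cvg_cst|apply: cvgB; [exact: cvg_id|exact: cvg_cst]].
apply: cvg_trans; apply: near_eq_cvg; rewrite near_withinE.
by apply: nearW => t It; rewrite (eigenfunction_growth Ix It).
Qed.

(** On B the norm of v is at least |v x|, which contradicts square integrability
on a set of infinite measure unless v x = 0. *)
Lemma eigenfunction_eq0 x (B : set R) : I x -> measurable B -> B `<=` I ->
  mu B = +oo%E -> (forall t, B t -> 0 <= k * (t - x)) -> v x = 0.
Proof.
move=> Ix mB BI Boo kB; apply/eqP; rewrite -rnorm_eq0; apply/negP => /negP vx0.
have vx : 0 < rnorm (v x) by rewrite lt_neqAle eq_sym vx0 rnorm_ge0.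
have [[mu_ u2] _ _] := hu.
have mu2 : measurable_fun I (fun t => (rnorm (u t) ^+ 2)%:E).
  apply/measurable_EFinP; apply: measurable_funX; apply/measurable_EFinP.
  exact: measurable_rnorm.
have : (\int[mu]_(t in B) (cst (rnorm (v x) ^+ 2)%:E) t <=
        \int[mu]_(t in I) (rnorm (u t) ^+ 2)%:E)%E.
  apply: (@le_trans _ _ (\int[mu]_(t in B) (rnorm (u t) ^+ 2)%:E)%E); last first.
    apply: ge0_subset_integral => //.
    by move=> t _; rewrite lee_fin sqr_ge0.
  apply: ae_ge0_le_integral; first exact: mB.
  - by move=> t _; rewrite /= lee_fin sqr_ge0.
  - exact: measurable_cst.
  - by move=> t _; rewrite lee_fin sqr_ge0.
  - exact: (measurable_funS mI BI).
  - apply: ae_lebesgueS uv => t ut Bt; rewrite lee_fin ut; last exact: BI.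
    rewrite (eigenfunction_growth Ix (BI _ Bt)) ler_sqr ?nnegrE ?mulr_ge0 ?expR_ge0 ?rnorm_ge0//.
    by rewrite ler_peMl ?rnorm_ge0// -expR0 ler_expR kB.
rewrite integral_cst; last exact: mB.
move=> /le_lt_trans/(_ u2) /(pmule_lt_pinfty (exprn_gt0 2 vx) (measure_ge0 _ _)) Blt.
suff : (mu B < +oo)%E by rewrite Boo ltxx.
exact: Blt.
Qed.

(** The exponential never vanishes, so a solution is zero as soon as its boundary
value is, and conversely. *)
Lemma eigenfunction_boundary_eq0 x a : I x -> closure I a -> (v a == 0) = (v x == 0).
Proof.
move=> Ix Ia; rewrite -!rnorm_eq0 (eigenfunction_growth_closure Ix Ia) mulf_eq0.
by rewrite gt_eqF ?expR_gt0.
Qed.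

End EigenfunctionGrowth.

Theorem theorem3p1 (R : realType) (H : completeNormedModType R[i])
  (dot : {dot H for (@Num.conj R[i])}) (hH : is_hilbert dot)
  (hsep : separable H) (hdim : exists h : H, h != 0)
  (a1 a3 : R) (ha : a1 < a3)
  (A1 A3 : linear_operator H)
  (hA1 : selfadjoint dot A1) (hA3 : selfadjoint dot A3)
  (Hm1 : negative_space dot A1) (Hm3 : negative_space dot A3)
  (W1 : {linear H -> H}) (hW1 : unitary dot W1) :
  point_spectrum (null101 a1 a3) (L_W Hm1 Hm3 a1 a3 W1) = set0.
Proof.
apply/seteqP; split=> // lam [u [unull [hu1 hu3 [x1 [x3 [[v1 [cv1 uv1 v1a]] [v3 [cv3 uv3 v3a]] x3E]]]]]].
apply: unull.
have I1 : `]-oo, a1[%classic (a1 - 1) by rewrite /= in_itv/= gtrBl.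
have I3 : `]a3, +oo[%classic (a3 + 1) by rewrite /= in_itv/= ltrDl ltr01.
have cl1 : closure `]-oo, a1[%classic a1.
  move=> B [r /= r0 rB]; exists (a1 - r / 2); split.
    by rewrite /= in_itv/= gtrBl divr_gt0.
  by apply: rB => /=; rewrite ltr_norml; apply/andP; split; lra.
have cl3 : closure `]a3, +oo[%classic a3.
  move=> B [r /= r0 rB]; exists (a3 + r / 2); split.
    by rewrite /= in_itv/= andbT ltrDl divr_gt0.
  by apply: rB => /=; rewrite ltr_norml; apply/andP; split; lra.
have o1 : open (`]-oo, a1[%classic : set R) by exact: interval_open.
have o3 : open (`]a3, +oo[%classic : set R) by exact: interval_open.
have b1 x := eigenfunction_boundary_eq0 hH hA1 o1 hu1 cv1 uv1 (x := x) (a := a1) ^~ cl1.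
have b3 x := eigenfunction_boundary_eq0 hH hA3 o3 hu3 cv3 uv3 (x := x) (a := a3) ^~ cl3.
suff [v10 v30] : v1 a1 = 0 /\ v3 a3 = 0.
  split.
    apply: ae_lebesgueS uv1 => t ut It; rewrite ut//; apply/eqP.
    by rewrite -(b1 t It) v10.
  apply: ae_lebesgueS uv3 => t ut It; rewrite ut//; apply/eqP.
  by rewrite -(b3 t It) v30.
have [k0|k0] := leP (complex.Im lam) 0.
  have v10 : v1 a1 = 0.
    apply/eqP; rewrite (b1 _ I1); apply/eqP.
    apply: (eigenfunction_eq0 hH hA1 o1 hu1 cv1 uv1 I1 (B := `]-oo, a1 - 1[%classic)).
    - exact: measurable_itv.
    - move=> t /=; rewrite !in_itv/=; lra.
    - by rewrite lebesgue_measure_itv/= ltNyr.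
    - by move=> t /=; rewrite in_itv/= => ht; rewrite mulr_le0//; lra.
  by split=> //; rewrite v3a x3E -v1a v10 linear0.
have v30 : v3 a3 = 0.
  apply/eqP; rewrite (b3 _ I3); apply/eqP.
  apply: (eigenfunction_eq0 hH hA3 o3 hu3 cv3 uv3 I3 (B := `]a3 + 1, +oo[%classic)).
  - exact: measurable_itv.
  - move=> t /=; rewrite !in_itv/= !andbT; lra.
  - by rewrite lebesgue_measure_itv/= ltry.
  - by move=> t /=; rewrite in_itv/= andbT => ht; rewrite mulr_ge0//; lra.
split=> //; rewrite v1a; apply/eqP; rewrite -(dnorm_eq0 dot) -hW1.1 -x3E -v3a v30.
by rewrite linear0r.
Qed.
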